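(* For all integers $n\ge0$ and each $t\in\{15,25,50,75,90,100,115,140,165,175,240,275\}$, \[c\phi_5(325n+t)\equiv0\pmod{13}.\]
   Context: $c\phi_5(n)$ denotes the number of $5$-colored generalized Frobenius partitions of $n$, defined by the generating function \[\sum_{n\ge0}c\phi_5(n)q^n=\frac{\sum_{m_1,\dots,m_4\in\mathbb{Z}}q^{\sum_{i=1}^4m_i^2+\sum_{1\le i<j\le4}m_im_j}}{\prod_{n\ge1}(1-q^n)^5}.\] *)

(* Defs.v *)
From HB Require Import structures.
From mathcomp Require Import all_boot all_order all_algebra.
From mathcomp Require Import finmap.
From mathcomp Require Import boolp classical_sets functions cardinality.
From mathcomp Require Import ring lra zify.

Set Implicit Arguments.
Unset Strict Implicit.
Unset Printing Implicit Defensive.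

Import Order.TTheory GRing.Theory Num.Theory.
Local Open Scope ring_scope.

(* Formal power series over the integers, as coefficient functions. *)
Definition fps := nat -> int.

Definition fps_mul (a b : fps) : fps :=
  fun n => \sum_(i < n.+1) a i * b (n - i)%N.

(* Long division by a series with constant term 1: [fps_div_seq a b n] lists
   the first [n] coefficients of a / b (see [fps_divK], [fps_div_uniq]). *)
Fixpoint fps_div_seq (a b : fps) (n : nat) : seq int :=
  if n is k.+1 then
    let s := fps_div_seq a b k in
    rcons s (a k - \sum_(i < k) s`_i * b (k - i)%N)
  else [::].

Definition fps_div (a b : fps) : fps := fun n => (fps_div_seq a b n.+1)`_n.

Lemma size_fps_div_seq a b n : size (fps_div_seq a b n) = n.
Proof. by elim: n => //= n IHn; rewrite size_rcons IHn. Qed.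

Lemma nth_fps_div_seq a b n i :
  (i < n)%N -> (fps_div_seq a b n)`_i = fps_div a b i.
Proof.
elim: n => // n IHn; rewrite ltnS leq_eqVlt => /orP[/eqP->//|lt_in].
by rewrite /= nth_rcons size_fps_div_seq lt_in IHn.
Qed.

Lemma fps_divE a b n :
  fps_div a b n = a n - \sum_(i < n) fps_div a b i * b (n - i)%N.
Proof.
rewrite {1}/fps_div /= nth_rcons size_fps_div_seq ltnn eqxx; congr (_ - _).
by apply: eq_bigr => i _; rewrite nth_fps_div_seq.
Qed.

Lemma fps_divK a b : b 0%N = 1 -> fps_mul (fps_div a b) b =1 a.
Proof.
move=> b0 n; rewrite /fps_mul big_ord_recr /= subnn b0 mulr1 (fps_divE a b n).
by rewrite addrC subrK.
Qed.

Lemma fps_div_uniq a b c :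
  b 0%N = 1 -> fps_mul c b =1 a -> c =1 fps_div a b.
Proof.
move=> b0 cb n; elim/ltn_ind: n => n IHn; rewrite fps_divE -cb /fps_mul.
rewrite big_ord_recr /= subnn b0 mulr1 addrC.
rewrite [X in _ - X](eq_bigr (fun i : 'I_n => c i * b (n - i)%N)) ?addrK//.
by move=> i _; rewrite IHn.
Qed.

Definition qform (m : {ffun 'I_4 -> int}) : int :=
  \sum_i m i ^+ 2 + \sum_(i : 'I_4) \sum_(j : 'I_4 | (i < j)%N) m i * m j.

(* The coefficient of q^n in the sum of q^(qform m) over m in Z^4, i.e. the
   number of m with qform m = n; this level set is finite by
   [finite_qform_level], so [fset_set] does not default to the empty set. *)
Definition theta : fps :=
  fun n => (#|` fset_set [set m | qform m = n%:Z]%classic|)%:Z.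

Lemma qform_ge (m : {ffun 'I_4 -> int}) (i : 'I_4) : m i ^+ 2 <= qform m *+ 2.
Proof.
have -> : qform m *+ 2 = \sum_j m j ^+ 2 + (\sum_j m j) ^+ 2.
  rewrite /qform; under [X in (_ + X) *+ 2]eq_bigr => j _ do rewrite big_mkcond.
  by rewrite !big_ord_recl !big_ord0 /=; ring.
rewrite (bigD1 i) //= -addrA lerDl addr_ge0 ?sqr_ge0 //.
by apply: sumr_ge0 => j _; rewrite sqr_ge0.
Qed.

Lemma finite_qform_level (n : nat) :
  finite_set [set m | qform m = n%:Z]%classic.
Proof.
pose g (f : {ffun 'I_4 -> 'I_(4 * n).+1}) : {ffun 'I_4 -> int} :=
  [ffun i => (f i : nat)%:Z - (2 * n)%:Z].
apply: (@sub_finite_set _ _ (g @` setT)%classic); last exact: finite_image.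
move=> m /= Qm; exists [ffun i => inord `|(m i + (2 * n)%:Z)%R|%N] => //.
apply/ffunP => i; rewrite !ffunE.
have := qform_ge m i; rewrite Qm => le_m.
have [lo hi] : - (2 * n)%:Z <= m i /\ m i <= (2 * n)%:Z by nia.
rewrite inordK; last by lia.
by rewrite abszE ger0_norm ?addrK//; lia.
Qed.

(* prod_(i >= 1) (1 - q^i)^5: factors with i > n do not affect the coefficient
   of q^n (see [euler5E]). *)
Definition euler5 : fps :=
  fun n => (\prod_(1 <= i < n.+1) (1 - 'X^i) ^+ 5 : {poly int})`_n.

Lemma euler5E n N : (n <= N)%N ->
  (\prod_(1 <= i < N.+1) (1 - 'X^i) ^+ 5 : {poly int})`_n = euler5 n.
Proof.
elim: N => [|N IHN]; first by rewrite leqn0 => /eqP->.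
rewrite leq_eqVlt => /orP[/eqP->//|lt_nN]; rewrite big_nat_recr //= -IHN //.
set p := \prod_(_ <= _ < _) _; set x : {poly int} := 'X^(N.+1).
have -> : p * (1 - x) ^+ 5 =
    p + p * (- 5%:R + 10%:R * x - 10%:R * x ^+ 2 + 5%:R * x ^+ 3 - x ^+ 4) * x.
  by ring.
by rewrite coefD coefMXn lt_nN addr0.
Qed.

Lemma euler5_0 : euler5 0 = 1.
Proof. by rewrite /euler5 big_geq // coef1. Qed.

(* The number of 5-colored generalized Frobenius partitions of n, defined by
   its generating function. *)
Definition cphi5 : fps := fps_div theta euler5.

Lemma cphi5_gen : fps_mul cphi5 euler5 =1 theta.
Proof. exact: fps_divK euler5_0. Qed.

(* Main.v *)
(* Write E_d for the product of the 1 - q^(d n), n >= 1, and C for the sum of the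
   cphi5(n) q^n, so that C E_1^5 is the theta series of the lattice A4. Map A4 to Z/5 by
   x |-> sum_i i x_i. Twisting the theta series by a nontrivial character of Z/5 gives
   E_1^5 / E_5, by the triple product, and the vectors of one fixed nonzero class are
   parametrized by the map gauss5, which scales the norm by 5; their theta series is
   5 q E_5^5 / E_1. Hence C E_1^6 E_5 = E_1^6 + 25 q E_5^6.

   Now work over a field of characteristic 13 with a primitive fifth root of unity. The
   5-dissection of E_1 has two parameters: s = R(q)^5 and k = R(q^5), for R the
   Rogers-Ramanujan continued fraction. It expresses the sum of the cphi5(5 m) q^m
   rationally in s. The derivation D = q d/dq satisfies D^13 = D; applied to s, which
   satisfies a third order differential equation, this gives a polynomial identity
   a^6 H(s) = 1, where H is the Hasse invariant. Substituting it yields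

     sum_m cphi5(5 m) q^(m + 1) = 5 q / E_1 + E_1^5 / E_5^6 - E_1 / E_13^2.

   When m is 0 or 3 modulo 5, the coefficients of q^(m + 1) in the first two terms cancel,
   and the last term only has exponents congruent to a pentagonal number modulo 13. *)
Require Import Defs.
From HB Require Import structures.
From mathcomp Require Import all_boot all_order all_algebra.
From mathcomp Require Import finmap all_fingroup all_solvable finfield.
From mathcomp Require Import boolp classical_sets cardinality.
From mathcomp Require Import ring zify.

Set Implicit Arguments.
Unset Strict Implicit.
Unset Printing Implicit Defensive.

Import Order.TTheory GRing.Theory Num.Theory.
Local Open Scope ring_scope.

(** * Formal power series *)

(** Modular identities are proved formally, by uniqueness. The relations between [s], [a] and their
    expansions at q^5 are algebraic over [k], so a conjectured differential equation, written Y = 0,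
    becomes a linear relation between Y(q) and Y(q^5). Vanishing to low order, or a scalar factor 25
    different from 1, then forces Y = 0.

    Weights explain the exponents. The series [a] has weight 2, so a^6 has weight 12 = 13 - 1, and
    a^6 H(s) = 1 is the level five form of the congruence of the Eisenstein series E_12 with 1
    modulo 13. The 5-dissection of C has a numerator that is a polynomial in s with no product
    formula of its own. Modulo 13 it can be traded for H, and after multiplication by a^6 every
    remaining term is a quotient of Euler products.

    The term E_1 / E_13^2 is E_1^(-25), rewritten by Frobenius. Two residues of m modulo 5, and the
    six residues modulo 13 for which m + 1 is not pentagonal, give the twelve values of t. *)

Record pser (R : Type) := Pser { pcoef :> nat -> R }.

Lemma pserP (R : Type) (f g : pser R) : f =1 g -> f = g.
Proof. by case: f g => [f] [g] /= /funext ->. Qed.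

HB.instance Definition _ (R : Type) := gen_eqMixin (pser R).
HB.instance Definition _ (R : Type) := gen_choiceMixin (pser R).

HB.lock Definition ps_mul (R : comNzRingType) (f g : pser R) : pser R :=
  Pser (fun n => \sum_(i < n.+1) f i * g (n - i)%N).

Definition ps_of (R : comNzRingType) (p : {poly R}) : pser R := Pser (fun n => p`_n).

Arguments ps_mul {R}.

HB.lock Definition psq (R : comNzRingType) : pser R := ps_of 'X.
Arguments psq {R}.

Section PowerSeriesRing.
Variable R : comNzRingType.
Implicit Types f g h : pser R.

Definition ps_zero : pser R := Pser (fun=> 0).
Definition ps_add f g : pser R := Pser (fun n => f n + g n).
Definition ps_opp f : pser R := Pser (fun n => - f n).

Let addA : associative ps_add.
Proof. by move=> f g h; apply: pserP => n /=; rewrite addrA. Qed.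
Let addC : commutative ps_add.
Proof. by move=> f g; apply: pserP => n /=; rewrite addrC. Qed.
Let add0 : left_id ps_zero ps_add.
Proof. by move=> f; apply: pserP => n /=; rewrite add0r. Qed.
Let addN : left_inverse ps_zero ps_opp ps_add.
Proof. by move=> f; apply: pserP => n /=; rewrite addNr. Qed.

HB.instance Definition _ := GRing.isZmodule.Build (pser R) addA addC add0 addN.

Definition ps_trunc N f : {poly R} := \poly_(i < N) f i.
Lemma coef_ps_mul f g n : ps_mul f g n = \sum_(i < n.+1) f i * g (n - i)%N.
Proof. by rewrite ps_mul.unlock. Qed.

Definition eqm N f g := forall i, (i < N)%N -> f i = g i.

Lemma eqm_trunc N f : eqm N f (ps_of (ps_trunc N f)).
Proof. by move=> i lt_iN /=; rewrite coef_poly lt_iN. Qed.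

Lemma ps_of_mul (p r : {poly R}) : ps_of (p * r) = ps_mul (ps_of p) (ps_of r).
Proof. by apply: pserP => n; rewrite coef_ps_mul /= coefM. Qed.

Lemma eqm_mul_raw N f f' g g' :
  eqm N f f' -> eqm N g g' -> eqm N (ps_mul f g) (ps_mul f' g').
Proof.
move=> ff gg n lt_nN; rewrite !coef_ps_mul; apply: eq_bigr => i _.
by rewrite ff ?gg //; case: i => i /=; lia.
Qed.

Lemma eqmP f g : (forall N, eqm N f g) -> f = g.
Proof. by move=> fg; apply: pserP => n; exact: (fg n.+1). Qed.

(** A coefficient of a product depends only on truncations of the factors, so the ring laws are
    inherited from polynomials. *)
Let mulA : associative (@ps_mul R).
Proof.
move=> f g h; apply: eqmP => N i lt_iN.
have F := @eqm_trunc N f; have G := @eqm_trunc N g; have H := @eqm_trunc N h.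
rewrite (eqm_mul_raw F (eqm_mul_raw G H)) // (eqm_mul_raw (eqm_mul_raw F G) H) //.
by rewrite -!ps_of_mul mulrA.
Qed.
Let mulC : commutative (@ps_mul R).
Proof.
move=> f g; apply: eqmP => N i lt_iN.
have F := @eqm_trunc N f; have G := @eqm_trunc N g.
by rewrite (eqm_mul_raw F G) // (eqm_mul_raw G F) // -!ps_of_mul mulrC.
Qed.
Let mul1 : left_id (ps_of 1) (@ps_mul R).
Proof.
move=> f; apply: eqmP => N i lt_iN; have F := @eqm_trunc N f.
rewrite (@eqm_mul_raw N _ (ps_of 1) _ _ _ F) // -ps_of_mul mul1r.
by rewrite F.
Qed.
Let mulD : left_distributive (@ps_mul R) (+%R : pser R -> pser R -> pser R).
Proof.
move=> f g h; apply: pserP => n /=; rewrite !coef_ps_mul -big_split /=.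
by apply: eq_bigr => i _; rewrite mulrDl.
Qed.
Let one_neq0 : ps_of 1 != 0 :> pser R.
Proof.
apply/negP => /eqP /(congr1 (fun f : pser R => f 0%N)) /= /eqP.
by rewrite coef1 oner_eq0.
Qed.

HB.instance Definition _ :=
  GRing.Zmodule_isComNzRing.Build (pser R) mulA mulC mul1 mulD one_neq0.

Lemma coef_ps1 n : (1 : pser R) n = (n == 0%N)%:R.
Proof. by rewrite -[LHS]/((1 : {poly R})`_n) coef1. Qed.
Lemma coef_psD f g n : (f + g) n = f n + g n. Proof. by []. Qed.
Lemma coef_psN f n : (- f) n = - f n. Proof. by []. Qed.
Lemma coef_psB f g n : (f - g) n = f n - g n. Proof. by []. Qed.
Lemma coef_psM f g n : (f * g) n = \sum_(i < n.+1) f i * g (n - i)%N.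
Proof. exact: coef_ps_mul. Qed.
Lemma coef_ps_sum I (r : seq I) (P : pred I) (F : I -> pser R) n :
  (\sum_(i <- r | P i) F i) n = \sum_(i <- r | P i) F i n.
Proof. by elim/big_rec2: _ => //= i y f _ <-. Qed.
Lemma coef_psMn f k n : (f *+ k) n = f n *+ k.
Proof. by elim: k => // k IH; rewrite !mulrS coef_psD IH. Qed.
Lemma coef_psM0 f g : (f * g) 0%N = f 0%N * g 0%N.
Proof. by rewrite coef_psM big_ord1. Qed.

Fact ps_of_additive : zmod_morphism (@ps_of R).
Proof. by move=> p r; apply: pserP => n /=; rewrite coefB. Qed.
HB.instance Definition _ :=
  GRing.isZmodMorphism.Build {poly R} (pser R) (@ps_of R) ps_of_additive.
Fact ps_of_multiplicative : monoid_morphism (@ps_of R).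
Proof. by split=> // p r; rewrite ps_of_mul. Qed.
HB.instance Definition _ :=
  GRing.isMonoidMorphism.Build {poly R} (pser R) (@ps_of R) ps_of_multiplicative.

Definition psC (c : R) : pser R := ps_of c%:P.
Fact psC_additive : zmod_morphism psC.
Proof. by move=> c d; rewrite /psC !rmorphB. Qed.
HB.instance Definition _ := GRing.isZmodMorphism.Build R (pser R) psC psC_additive.
Fact psC_multiplicative : monoid_morphism psC.
Proof. by split=> [|c d]; rewrite /psC ?rmorph1 // !rmorphM. Qed.
HB.instance Definition _ :=
  GRing.isMonoidMorphism.Build R (pser R) psC psC_multiplicative.

Lemma coef_psC c n : psC c n = if n == 0%N then c else 0.
Proof. by rewrite /psC /= coefC. Qed.

Lemma coef_psCM c f n : (psC c * f) n = c * f n.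
Proof.
rewrite coef_psM big_ord_recl coef_psC /= subn0 big1 ?addr0 // => i _.
by rewrite coefC mul0r.
Qed.

Lemma psqX n : psq ^+ n = ps_of 'X^n. Proof. by rewrite psq.unlock -rmorphXn. Qed.

Lemma coef_psqX k n : (psq ^+ k) n = (n == k)%:R.
Proof. by rewrite psqX /= coefXn. Qed.

Lemma coef_psqXM k f n : (psq ^+ k * f) n = if (n < k)%N then 0 else f (n - k)%N.
Proof.
have F := @eqm_trunc n.+1 f.
have := @eqm_mul_raw n.+1 _ (psq ^+ k) _ _ (fun i _ => erefl) F.
move=> /(_ n (ltnSn _)); rewrite -[ps_mul _ _]/(psq ^+ k * f) => ->.
rewrite {1}psqX -ps_of_mul /= coefXnM; case: ltnP => // _.
by rewrite coef_poly ltnS leq_subr.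
Qed.

Lemma psqX_inj k f g : psq ^+ k * f = psq ^+ k * g -> f = g.
Proof.
move=> eq_fg; apply: pserP => n.
have : (psq ^+ k * f) (n + k)%N = (psq ^+ k * g) (n + k)%N by rewrite eq_fg.
by rewrite !coef_psqXM ltnNge leq_addl /= addnK.
Qed.

Lemma psq_inj f g : psq * f = psq * g -> f = g.
Proof. by rewrite -[psq]expr1; exact: psqX_inj. Qed.

Lemma eqm_refl N f : eqm N f f. Proof. by []. Qed.
Lemma eqm_eq N f g : f = g -> eqm N f g. Proof. by move->. Qed.
Lemma eqm_sym N f g : eqm N f g -> eqm N g f.
Proof. by move=> fg i /fg. Qed.
Lemma eqm_trans N f g h : eqm N f g -> eqm N g h -> eqm N f h.
Proof. by move=> fg gh i lt_iN; rewrite fg // gh. Qed.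
Lemma eqm_le M N f g : (M <= N)%N -> eqm N f g -> eqm M f g.
Proof. by move=> le_MN fg i lt_iM; apply: fg; exact: leq_trans le_MN. Qed.
Lemma eqmD N f f' g g' : eqm N f f' -> eqm N g g' -> eqm N (f + g) (f' + g').
Proof. by move=> ff gg i lt_iN; rewrite !coef_psD ff ?gg. Qed.
Lemma eqmN N f f' : eqm N f f' -> eqm N (- f) (- f').
Proof. by move=> ff i lt_iN; rewrite !coef_psN ff. Qed.
Lemma eqmM N f f' g g' : eqm N f f' -> eqm N g g' -> eqm N (f * g) (f' * g').
Proof. exact: eqm_mul_raw. Qed.
Lemma eqmX N f f' k : eqm N f f' -> eqm N (f ^+ k) (f' ^+ k).
Proof.
by move=> ff; elim: k => // k IH; rewrite !exprS; exact: eqmM.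
Qed.
Lemma eqm_sum N I (r : seq I) (P : pred I) (F G : I -> pser R) :
  (forall i, P i -> eqm N (F i) (G i)) ->
  eqm N (\sum_(i <- r | P i) F i) (\sum_(i <- r | P i) G i).
Proof. by move=> FG; elim/big_rec2: _ => // i f g Pi; apply: eqmD; exact: FG. Qed.

Lemma eqm0_qXM N k f : (N <= k)%N -> eqm N (psq ^+ k * f) 0.
Proof. by move=> le_Nk i lt_iN; rewrite coef_psqXM (leq_trans lt_iN). Qed.

Lemma eqm_mulq N k f g : eqm N f g -> eqm (N + k) (psq ^+ k * f) (psq ^+ k * g).
Proof.
by move=> fg i lt_i; rewrite !coef_psqXM; case: ltnP => // ?; rewrite fg //; lia.
Qed.

Lemma eqm0_qXI N k f : eqm (N + k) (psq ^+ k * f) 0 -> eqm N f 0.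
Proof.
move=> f0 i lt_i; have := f0 (i + k)%N; rewrite coef_psqXM ltn_add2r addnK.
by rewrite [(i + k < k)%N]ltnNge leq_addl /=; exact.
Qed.

(* The geometric series in [1 - f]; it inverts [f] only when [f 0 = 1]. *)
Definition psV f : pser R := Pser (fun n => (\sum_(i < n.+1) (1 - f) ^+ i) n).

Lemma eqm0_exp f k : f 0%N = 0 -> eqm k (f ^+ k) 0.
Proof.
move=> f0; elim: k => [|k IH] i lt_ik //.
rewrite exprS coef_psM big_ord_recl f0 mul0r add0r big1 // => j _.
by rewrite IH ?mulr0 // lift0; case: j => j /=; lia.
Qed.

Lemma psVE N f : f 0%N = 1 -> eqm N (psV f) (\sum_(i < N) (1 - f) ^+ i).
Proof.
move=> f0 n lt_nN; rewrite -(subnKC lt_nN) big_split_ord /=.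
rewrite [X in _ = _ + X]coef_ps_sum [X in _ = _ + X]big1 ?addr0 // => i _.
apply: (@eqm0_exp _ (n.+1 + i)); last by rewrite addSn ltnS leq_addr.
by rewrite coef_psB f0 coef_ps1 subrr.
Qed.

Lemma psVr f : f 0%N = 1 -> f * psV f = 1.
Proof.
move=> f0; apply: eqmP => N; apply: eqm_trans (eqmM (@eqm_refl N f) (psVE f0)) _.
have {1}-> : f = 1 - (1 - f) by rewrite opprB addrC subrK.
rewrite -[1 - (1 - f)]opprB mulNr -subrX1 opprB -[X in eqm N _ X]subr0.
apply: eqmD => //; apply/eqmN/eqm0_exp.
by rewrite coef_psB f0 coef_ps1 subrr.
Qed.

Lemma psV0 f : f 0%N = 1 -> psV f 0%N = 1.
Proof.
move=> f0; have := congr1 (fun h : pser R => h 0%N) (psVr f0).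
by rewrite coef_psM0 f0 mul1r coef_ps1.
Qed.

Lemma psI f g h : f 0%N = 1 -> f * g = f * h -> g = h.
Proof.
move=> f0 /(congr1 ( *%R (psV f))); rewrite !mulrA ![psV f * f]mulrC psVr //.
by rewrite !mul1r.
Qed.

Lemma eqmI N f g h : f 0%N = 1 -> eqm N (f * g) (f * h) -> eqm N g h.
Proof.
move=> f0 /(eqmM (@eqm_refl N (psV f))).
by rewrite !mulrA ![psV f * f]mulrC psVr // !mul1r.
Qed.

Lemma ps_exp0 f k : f 0%N = 1 -> (f ^+ k) 0%N = 1.
Proof.
by move=> f0; elim: k => [|k IH]; rewrite ?exprS ?coef_psM0 ?f0 ?IH ?mulr1 // coef_ps1.
Qed.

(** The derivation q d/dq, not a theta series. *)
Definition ps_theta f : pser R := Pser (fun n => n%:R * f n).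

Lemma coef_ps_theta f n : ps_theta f n = n%:R * f n. Proof. by []. Qed.

Lemma ps_thetaM f g : ps_theta (f * g) = ps_theta f * g + f * ps_theta g.
Proof.
apply: pserP => n; rewrite coef_psD coef_ps_theta !coef_psM mulr_sumr -big_split /=.
apply: eq_bigr => i _; have le_in : (i <= n)%N by rewrite -ltnS.
by rewrite -{1}(subnKC le_in) natrD; ring.
Qed.

Lemma ps_thetaD f g : ps_theta (f + g) = ps_theta f + ps_theta g.
Proof. by apply: pserP => n /=; rewrite mulrDr. Qed.
Lemma ps_thetaN f : ps_theta (- f) = - ps_theta f.
Proof. by apply: pserP => n /=; rewrite mulrN. Qed.
Lemma ps_thetaC c : ps_theta (psC c) = 0.
Proof.
by apply: pserP => n /=; rewrite coefC; case: eqP => [->|_]; rewrite ?mul0r ?mulr0.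
Qed.
Lemma ps_theta1 : ps_theta 1 = 0.
Proof. by rewrite -(rmorph1 psC) ps_thetaC. Qed.
Lemma ps_thetaMn f k : ps_theta (f *+ k) = ps_theta f *+ k.
Proof.
elim: k => [|k IH]; last by rewrite !mulrS ps_thetaD IH.
by apply: pserP => n /=; rewrite mulr0.
Qed.
Lemma ps_theta_nat k : ps_theta k%:R = 0.
Proof. by rewrite ps_thetaMn ps_theta1 mul0rn. Qed.
Lemma ps_thetaX f k : ps_theta (f ^+ k.+1) = f ^+ k * ps_theta f *+ k.+1.
Proof.
elim: k => [|k IH]; first by rewrite !expr1 expr0 mul1r.
by rewrite exprS ps_thetaM IH mulrnAr mulrA -exprS mulrC -mulrS.
Qed.

(** The substitution of z q for q. For fifth roots of unity these are the conjugations over the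
    series in q^5. *)
Definition ps_dil (z : R) f : pser R := Pser (fun n => z ^+ n * f n).
Lemma coef_ps_dil z f n : ps_dil z f n = z ^+ n * f n. Proof. by []. Qed.
Fact ps_dil_additive z : zmod_morphism (ps_dil z).
Proof. by move=> f g; apply: pserP => n /=; rewrite mulrBr. Qed.
HB.instance Definition _ z :=
  GRing.isZmodMorphism.Build (pser R) (pser R) (ps_dil z) (ps_dil_additive z).
Fact ps_dil_multiplicative z : monoid_morphism (ps_dil z).
Proof.
split=> [|f g]; apply: pserP => n; rewrite ?coef_psM coef_ps_dil.
  by rewrite coef_ps1; case: eqP => [->|_]; rewrite ?mulr1 ?mulr0.
rewrite coef_psM mulr_sumr; apply: eq_bigr => i _; have le_in : (i <= n)%N by rewrite -ltnS.
by rewrite -{1}(subnKC le_in) exprD mulrACA.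
Qed.
HB.instance Definition _ z :=
  GRing.isMonoidMorphism.Build (pser R) (pser R) (ps_dil z) (ps_dil_multiplicative z).

Lemma ps_dilqX z k : ps_dil z (psq ^+ k) = psC (z ^+ k) * psq ^+ k.
Proof.
apply: pserP => n; rewrite coef_psCM coef_psqX /= !coef_psqX.
by case: eqP => [->|_]; rewrite ?mulr0.
Qed.

End PowerSeriesRing.

Section Expansion.
Variables (R : comNzRingType) (d : nat).
Hypothesis d_gt0 : (0 < d)%N.
Implicit Types f g : pser R.

Definition ps_expand f : pser R :=
  Pser (fun n => if (d %| n)%N then f (n %/ d)%N else 0).

Lemma ps_expand_of (p : {poly R}) : ps_expand (ps_of p) = ps_of (p \Po 'X^d).
Proof. by apply: pserP => n /=; rewrite coef_comp_poly_Xn. Qed.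

Lemma eqm_expand_mul N f g : eqm N f g -> eqm (d * N) (ps_expand f) (ps_expand g).
Proof. by move=> fg n lt_nN /=; case: ifP => // _; rewrite fg // ltn_divLR // mulnC. Qed.

Lemma eqm_expand N f g : eqm N f g -> eqm N (ps_expand f) (ps_expand g).
Proof. by move=> /eqm_expand_mul; apply: eqm_le; rewrite leq_pmull. Qed.

Lemma ps_expandM f g : ps_expand (f * g) = ps_expand f * ps_expand g.
Proof.
apply: eqmP => N; have F := @eqm_trunc _ N f; have G := @eqm_trunc _ N g.
apply: eqm_trans (eqm_expand (eqmM F G)) _.
rewrite -rmorphM ps_expand_of rmorphM rmorphM /= -!ps_expand_of.
by apply/eqm_sym; apply: eqmM; exact: eqm_expand.
Qed.
Lemma ps_expandB f g : ps_expand (f - g) = ps_expand f - ps_expand g.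
Proof. by apply: pserP => n /=; case: ifP; rewrite ?subr0. Qed.
Lemma ps_expandD f g : ps_expand (f + g) = ps_expand f + ps_expand g.
Proof. by apply: pserP => n /=; case: ifP; rewrite ?addr0. Qed.
Lemma ps_expandN f : ps_expand (- f) = - ps_expand f.
Proof. by apply: pserP => n /=; case: ifP; rewrite ?oppr0. Qed.
Lemma ps_expand1 : ps_expand 1 = 1.
Proof. by rewrite -(rmorph1 (@ps_of R)) ps_expand_of -polyC1 comp_polyC. Qed.
Lemma ps_expandX f k : ps_expand (f ^+ k) = ps_expand f ^+ k.
Proof. by elim: k => [|k IH]; rewrite ?ps_expand1 // !exprS ps_expandM IH. Qed.
Lemma ps_expandMn f k : ps_expand (f *+ k) = ps_expand f *+ k.
Proof.
elim: k => [|k IH]; last by rewrite !mulrS ps_expandD IH.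
by apply: pserP => n /=; case: ifP.
Qed.
Lemma ps_expand_nat k : ps_expand k%:R = k%:R.
Proof. by rewrite ps_expandMn ps_expand1. Qed.
Lemma ps_expandq : ps_expand psq = psq ^+ d.
Proof. by rewrite psq.unlock ps_expand_of comp_polyX rmorphXn. Qed.
Lemma ps_expand_prod I (r : seq I) (P : pred I) (F : I -> pser R) :
  ps_expand (\prod_(i <- r | P i) F i) = \prod_(i <- r | P i) ps_expand (F i).
Proof. by apply: (big_morph _ ps_expandM ps_expand1). Qed.

Lemma ps_expand_sum I (r : seq I) (P : pred I) (F : I -> pser R) :
  ps_expand (\sum_(i <- r | P i) F i) = \sum_(i <- r | P i) ps_expand (F i).
Proof. by apply: (big_morph _ ps_expandD); apply: pserP => n /=; case: ifP. Qed.

Lemma coef_expand0 f : ps_expand f 0%N = f 0%N.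
Proof. by rewrite /= dvdn0 div0n. Qed.
Lemma coef_expand f n : ps_expand f (d * n)%N = f n.
Proof. by rewrite /= dvdn_mulr // mulKn. Qed.
Lemma ps_expand_inj f g : ps_expand f = ps_expand g -> f = g.
Proof.
by move=> fg; apply: pserP => n; rewrite -(coef_expand f) fg coef_expand.
Qed.

Lemma ps_theta_expand f : ps_theta (ps_expand f) = ps_expand (ps_theta f) *+ d.
Proof.
apply: pserP => n; rewrite coef_psMn /=; case: ifP => [dn|_]; last first.
  by rewrite mulr0 mul0rn.
by rewrite -[RHS]mulr_natl mulrA -natrM mulnC divnK.
Qed.

End Expansion.

Section Map.
Variables (R S : comNzRingType).

Definition ps_map (phi : R -> S) (f : pser R) : pser S := Pser (fun n => phi (f n)).

Lemma eqm_map N phi f g : eqm N f g -> eqm N (ps_map phi f) (ps_map phi g).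
Proof. by move=> fg i lt_iN /=; rewrite fg. Qed.

Fact ps_map_additive (phi : {additive R -> S}) : zmod_morphism (ps_map phi).
Proof. by move=> f g; apply: pserP => n /=; rewrite raddfB. Qed.
HB.instance Definition _ (phi : {additive R -> S}) :=
  GRing.isZmodMorphism.Build (pser R) (pser S) (ps_map phi) (@ps_map_additive phi).

Variable phi : {rmorphism R -> S}.

Fact ps_map_multiplicative : monoid_morphism (ps_map phi).
Proof.
split=> [|f g]; apply: pserP => n; first by rewrite /= !coef1 rmorph_nat.
by rewrite /= !coef_psM rmorph_sum; apply: eq_bigr => i _; rewrite rmorphM.
Qed.
HB.instance Definition _ :=
  GRing.isMonoidMorphism.Build (pser R) (pser S) (ps_map phi) ps_map_multiplicative.

Lemma ps_mapq : ps_map phi psq = psq.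
Proof. by apply: pserP => n; rewrite !psq.unlock /= !coefX rmorph_nat. Qed.

Lemma ps_mapC c : ps_map phi (psC c) = psC (phi c).
Proof. by apply: pserP => n /=; rewrite !coefC; case: eqP; rewrite ?rmorph0. Qed.

End Map.

(** * Euler products and the triple product *)

HB.lock Definition eulerp (R : comNzRingType) d m : pser R :=
  \prod_(i < m) (1 - psq ^+ (d * i.+1)).

(* prod_(i >= 1) (1 - q^(d i)): factors with i > n + 1 do not affect the coefficient of
   q^n. Junk value for d = 0. *)
HB.lock Definition euler (R : comNzRingType) d : pser R := Pser (fun n => eulerp R d n.+1 n).

Section Euler.
Variable R : comNzRingType.
Local Notation eulerp := (eulerp R).
Local Notation euler := (euler R).

Lemma eulerpE d m : eulerp d m = \prod_(i < m) (1 - psq ^+ (d * i.+1)).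
Proof. by rewrite eulerp.unlock. Qed.
Lemma coef_euler d n : euler d n = eulerp d n.+1 n.
Proof. by rewrite euler.unlock. Qed.

Lemma eulerpS d m : eulerp d m.+1 = eulerp d m * (1 - psq ^+ (d * m.+1)).
Proof. by rewrite !eulerpE big_ord_recr. Qed.

Lemma eulerp_nil d : eulerp d 0 = 1. Proof. by rewrite eulerpE big_ord0. Qed.

Lemma eqm_eulerp d m m' : (m <= m')%N -> eqm (d * m.+1) (eulerp d m') (eulerp d m).
Proof.
move=> /subnK <-; elim: (m' - m)%N => // k IH; rewrite addSn eulerpS.
rewrite -[X in eqm _ _ X]mulr1; apply: eqmM => //.
rewrite -[X in eqm _ _ X]subr0; apply: eqmD => //; apply: eqmN.
by rewrite -[_ ^+ _]mulr1; apply: eqm0_qXM; rewrite leq_mul2l ltnS leq_addl orbT.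
Qed.

Lemma eqm_euler d m N : (0 < d)%N -> (N <= d * m.+1)%N -> eqm N (euler d) (eulerp d m).
Proof.
move=> d0 le_N i lt_iN; rewrite coef_euler; case: (leqP m i.+1) => le_mi.
  apply: (eqm_eulerp le_mi); exact: leq_trans le_N.
by rewrite [RHS](eqm_eulerp (ltnW le_mi)) //; nia.
Qed.

Lemma eulerp0 d m : (0 < d)%N -> eulerp d m 0%N = 1.
Proof.
move=> d0; elim: m => [|m IH]; first by rewrite eulerp_nil coef_ps1.
by rewrite eulerpS coef_psM0 IH mul1r coef_psB coef_ps1 coef_psqX eqxx eq_sym muln_eq0 eqn0Ngt d0 subr0.
Qed.

Lemma euler0 d : (0 < d)%N -> euler d 0%N = 1.
Proof. by move=> d0; rewrite coef_euler eulerp0. Qed.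

Lemma ps_expand_euler c d : (0 < c)%N -> (0 < d)%N -> ps_expand c (euler d) = euler (c * d).
Proof.
move=> c0 d0; apply: eqmP => N.
have E : eqm N (euler d) (eulerp d N) by apply: eqm_euler => //; nia.
apply: eqm_trans (eqm_expand c0 E) _; rewrite eulerpE ps_expand_prod //.
under eq_bigr => i _ do
  rewrite ps_expandB ps_expand1 // ps_expandX // ps_expandq // -exprM mulnA.
by rewrite -eulerpE; apply/eqm_sym/eqm_euler; nia.
Qed.

End Euler.

Lemma ps_map_eulerp (R S : comNzRingType) (phi : {rmorphism R -> S}) d m :
  ps_map phi (eulerp R d m) = eulerp S d m.
Proof.
rewrite !eulerpE rmorph_prod; apply: eq_bigr => i _.
by rewrite rmorphB rmorph1 rmorphXn /= ps_mapq.
Qed.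

Lemma ps_map_euler (R S : comNzRingType) (phi : {rmorphism R -> S}) d :
  ps_map phi (euler R d) = euler S d.
Proof. by apply: pserP => n /=; rewrite !coef_euler -(ps_map_eulerp phi). Qed.

(** * Gaussian binomials and the q-binomial theorem *)

Section GaussBinomial.
Variables (L : comNzRingType) (c : nat).
Hypothesis c_gt0 : (0 < c)%N.
Local Notation Q := (psq ^+ c : pser L).

(** The Gaussian binomial to base q^c, given by a Pascal rule to avoid division; [qbin_euler]
    recovers the quotient formula. *)
Fixpoint qbin n k : pser L :=
  match n, k with
  | _, 0 => 1
  | 0, _ => 0
  | n'.+1, k'.+1 => qbin n' k + Q ^+ (n' - k') * qbin n' k'
  end.

#[local] Arguments qbin : simpl never.

Lemma qbin0 n : qbin n 0 = 1. Proof. by case: n. Qed.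
Lemma qbinS n k : qbin n.+1 k.+1 = qbin n k.+1 + Q ^+ (n - k) * qbin n k.
Proof. by []. Qed.

Lemma qbin_small n k : (n < k)%N -> qbin n k = 0.
Proof.
elim: n k => [|n IH] [|k] // lt_nk; rewrite qbinS !IH ?mulr0 ?addr0 //.
exact: ltnW.
Qed.

Lemma qbin_euler n k : (k <= n)%N ->
  qbin n k * (eulerp L c k * eulerp L c (n - k)) = eulerp L c n.
Proof.
elim: n k => [|n IH] [|k] // le_kn.
- by rewrite qbin0 !mul1r eulerp_nil ?mul1r.
- by rewrite qbin0 subn0 eulerp_nil !mul1r.
rewrite subSS qbinS mulrDl eulerpS -!mulrA.
have IHk := IH k le_kn.
have -> : Q ^+ (n - k) * (qbin n k * (eulerp L c k *
    ((1 - psq ^+ (c * k.+1)) * eulerp L c (n - k)))) =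
    Q ^+ (n - k) * (1 - Q ^+ k.+1) * eulerp L c n.
  by rewrite -IHk exprM; ring.
have -> : qbin n k.+1 * (eulerp L c k *
    ((1 - psq ^+ (c * k.+1)) * eulerp L c (n - k))) = (1 - Q ^+ (n - k)) * eulerp L c n.
  move: le_kn; rewrite ltnS leq_eqVlt => /orP[/eqP->|lt_kn].
    by rewrite qbin_small // subnn subrr !mul0r.
  rewrite -(IH k.+1) //; have -> : (n - k = (n - k.+1).+1)%N by lia.
  by rewrite !eulerpS -!exprM; ring.
rewrite eulerpS exprM -[n.+1](_ : (n - k) + k.+1 = n.+1)%N ?exprD; last by lia.
by ring.
Qed.

(** When k and n - k both grow, the Gaussian binomial tends to 1 / E_c; the modulus records the
    rate, which the triple product needs. *)
Lemma qbin_limit n k : (k <= n)%N ->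
  eqm (c * (minn k (n - k)).+1) (euler L c * qbin n k) 1.
Proof.
move=> le_kn; set M := (c * _)%N.
have E m : (minn k (n - k) <= m)%N -> eqm M (eulerp L c m) (euler L c).
  by move=> le_m; apply/eqm_sym/eqm_euler => //; rewrite leq_mul2l ltnS le_m orbT.
have H : eqm M (qbin n k * (euler L c * euler L c)) (euler L c).
  apply: eqm_trans (E n _); last by rewrite geq_min le_kn.
  rewrite -(qbin_euler le_kn); apply: eqmM => //.
  by apply/eqm_sym; apply: eqmM; apply: E; rewrite ?geq_minl ?geq_minr.
apply: (@eqmI _ _ (euler L c)); first exact: euler0.
by rewrite mulr1 mulrA mulrC.
Qed.

Lemma qbin_theorem n (z S : pser L) :
  \prod_(i < n) (S + z * Q ^+ i) =
  \sum_(j < n.+1) Q ^+ 'C(j, 2) * qbin n j * z ^+ j * S ^+ (n - j).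
Proof.
elim: n => [|n IH].
  by rewrite big_ord0 big_ord1 /= qbin0 !expr0 !mulr1.
rewrite big_ord_recr /= {}IH mulrDr !big_distrl /=.
rewrite [RHS]big_ord_recl /= /bump /= qbin0 bin0n !expr0 !mul1r subn0.
under [X in _ = _ + X]eq_bigr => i _ do
  rewrite add1n qbinS mulrDr 2!mulrDl binS bin1 subSS.
rewrite big_split /= addrA; congr (_ + _).
  rewrite big_ord_recl /= qbin0 bin0n !expr0 !mul1r subn0 -exprSr; congr (_ + _).
  rewrite [RHS]big_ord_recr /= qbin_small // mulr0 !mul0r addr0.
  apply: eq_bigr => i _; rewrite /bump /= add1n binS bin1.
  by rewrite -mulrA -exprSr -subSn ?subSS.
apply: eq_bigr => i _; have le_in : (i <= n)%N by rewrite -ltnS.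
have -> : Q ^+ n = Q ^+ (n - i) * Q ^+ i by rewrite -exprD subnK.
by rewrite [z ^+ i.+1]exprS [Q ^+ (_ + _)]exprD; ring.
Qed.

End GaussBinomial.

Arguments qbin L c n k : simpl never.

(** The symmetry i -> -1 - i of i (i + 1) / 2 exchanges the two constructors of [int], hence the
    same binomial twice. *)
Definition tri (i : int) : nat :=
  match i with Posz m => 'C(m.+1, 2) | Negz m => 'C(m.+1, 2) end.

Lemma bin2z n : ('C(n, 2))%:Z * 2 = n%:Z * (n%:Z - 1).
Proof.
by elim: n => // n IH; rewrite binS bin1 PoszD mulrDl IH; lia.
Qed.

Arguments tri : simpl never.

Lemma triE i : (tri i)%:Z * 2 = i * (i + 1).
Proof. by case: i => m; rewrite /tri bin2z ?NegzE; lia. Qed.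

Lemma tri_ge i : (`|i| - 1 <= tri i)%N.
Proof. by have := triE i; nia. Qed.

Section TripleProduct.
Variables (L : comNzRingType) (a b : nat).
Local Notation c := (a + b)%N.
Hypothesis c_gt0 : (0 < c)%N.

(** Half of (a + b) i^2 + (a - b) i, the exponent in Ramanujan's general theta function. *)
Definition jexp (i : int) := (a * tri i + b * tri (- i))%N.

(** Jacobi's product multiplied by z^N, so that z need not be invertible: 1 + z^(-1) q^(b + c n)
    becomes z + q^(b + c n). Accordingly z^j in [jsum] stands for the power j - N. *)
Definition jprod N (z : pser L) : pser L :=
  \prod_(n < N) ((z + psq ^+ (b + c * n)) * (1 + z * psq ^+ (a + c * n))).

Definition jsum N (z : pser L) : pser L :=
  \sum_(j < N.*2.+1) psq ^+ jexp (j%:Z - N%:Z) * z ^+ j.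

Lemma jprod_finite N z :
  jprod N z =
  \sum_(j < N.*2.+1) psq ^+ jexp (j%:Z - N%:Z) * qbin L c N.*2 j * z ^+ j.
Proof.
case: N => [|N].
  by rewrite /jprod big_ord0 big_ord1 subrr /jexp /= !muln0 !expr0 qbin0 !mulr1.
(* The product of the S + z q^(c i) over i < 2 M splits in two halves. Taking q^(c i) out of the
   first and S out of the second leaves exactly the two families of factors of [jprod]; this
   dictates the exponent of S. *)
set M := N.+1; pose S : pser L := psq ^+ (b + c * N).
have shift : \prod_(i < M.*2) (S + z * psq ^+ c ^+ i) =
    psq ^+ (c * 'C(M, 2) + (b + c * N) * M) * jprod M z.
  rewrite [X in _ = X * _]exprD /jprod big_split /= mulrACA -addnn big_split_ord /=; congr (_ * _).
    transitivity (\prod_(i < M) (psq ^+ (c * i) * (z + psq ^+ (b + c * (N - i))) : pser L)).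
      apply: eq_bigr => i _; have le_i : (i <= N)%N by rewrite -ltnS.
      rewrite mulrDr -exprD -exprM addrC mulrC; congr (_ + _ ^+ _).
      by rewrite -{1}(subnKC le_i); lia.
    rewrite big_split /=; congr (_ * _).
      by rewrite prodrXr -big_distrr /= -bin2_sum big_mkord.
    by rewrite (reindex_inj rev_ord_inj) /=; apply: eq_bigr => i _; rewrite subSS subKn // -ltnS.
  transitivity (\prod_(i < M) (S * (1 + z * psq ^+ (a + c * i)))).
    apply: eq_bigr => i _; rewrite mulrDr mulr1; congr (_ + _).
    rewrite mulrCA -exprD -exprM; congr (_ * _ ^+ _).
    by rewrite /M; lia.
  by rewrite big_split /= prodr_const card_ord -exprM.
apply: (psqX_inj (k := c * 'C(M, 2) + (b + c * N) * M)).
rewrite -shift qbin_theorem // mulr_sumr; apply: eq_bigr => j _.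
have le_j : (j <= M.*2)%N by rewrite -ltnS.
have expE : (c * 'C(j, 2) + (b + c * N) * (M.*2 - j) =
    c * 'C(M, 2) + (b + c * N) * M + jexp (j%:Z - M%:Z))%N.
  have := bin2z j; have := bin2z M; have := triE (j%:Z - M%:Z).
  have := triE (- (j%:Z - M%:Z)); rewrite /jexp.
  move: ('C(j, 2)) ('C(M, 2)) (tri _) (tri _) => x y u v; rewrite /M in le_j *.
  move: (nat_of_ord j) le_j => {}j le_j hu hv hy hx.
  have {le_j} [k ek] : exists k, N.+1.*2 = (j + k)%N by exists (N.+1.*2 - j)%N; lia.
  rewrite ek addKn; apply/eqP; rewrite -eqz_nat; apply/eqP.
  have ek' : k%:Z = N%:Z * 2 + 2 - j%:Z by lia.
  rewrite !(PoszD, PoszM) ek'; apply: (mulIf (_ : 2 != 0 :> int)) => //.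
  rewrite !mulrDl -!mulrA.
  rewrite !(mulrC _ 2) !mulrA.
  nia.
by rewrite !mulrA -exprD -expE -!exprM exprD; ring.
Qed.

Lemma jexp_ge i : (`|i| - 1 <= jexp i)%N.
Proof. by have := tri_ge i; have := tri_ge (- i); rewrite /jexp; nia. Qed.

(** In the term of index j, [qbin_limit] is precise to order c (N - |j - N| + 1), and the factor
    q^[jexp] adds at least |j - N| - 1 to it. Together they give precision N uniformly in j. *)
Lemma triple_product N z : eqm N (euler L c * jprod N z) (jsum N z).
Proof.
rewrite jprod_finite mulr_sumr; apply: eqm_sum => j _.
have le_j : (j <= N.*2)%N by rewrite -ltnS.
rewrite mulrA; apply: eqmM => //; rewrite mulrCA -[X in eqm _ _ X]mulr1.
have H := @eqm_mulq _ _ (jexp (j%:Z - N%:Z)) _ _ (qbin_limit L c_gt0 le_j).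
apply: (eqm_le _ H) => {H}.
have := jexp_ge (j%:Z - N%:Z); move: (jexp _) => x.
rewrite minnE; move: (nat_of_ord j) le_j => {}j; nia.
Qed.

End TripleProduct.

Definition bisum (V : zmodType) N (F : int -> V) : V :=
  \sum_(j < N.*2.+1) F (j%:Z - N%:Z).

(** The bound 5 N + 2 makes the interval from -(5 N + 2) to 5 N + 2 the disjoint union of five
    complete classes 5 j + r, with |j| <= N and |r| <= 2. *)
Lemma bisum_split5 (V : zmodType) N (F : int -> V) :
  bisum (5 * N + 2) F =
  bisum N (fun j => F (5 * j - 2)) + bisum N (fun j => F (5 * j - 1)) +
  bisum N (fun j => F (5 * j)) + bisum N (fun j => F (5 * j + 1)) +
  bisum N (fun j => F (5 * j + 2)).
Proof.
have split m (G : nat -> V) : \sum_(i < 5 * m) G i = \sum_(j < m)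
    (G (5 * j)%N + G (5 * j + 1)%N + G (5 * j + 2)%N + G (5 * j + 3)%N + G (5 * j + 4)%N).
  elim: m => [|m IH]; first by rewrite muln0 !big_ord0.
  by rewrite mulnSr !addnS addn0 !big_ord_recr /= IH !addnS !addn0 !addrA.
rewrite /bisum -!big_split /= (_ : (5 * N + 2).*2.+1 = 5 * N.*2.+1)%N; last by lia.
rewrite (split _ (fun i => F (i%:Z - (5 * N + 2)%N%:Z))); apply: eq_bigr => j _.
by rewrite /=; congr (F _ + F _ + F _ + F _ + F _); lia.
Qed.

Lemma bisum_opp (V : zmodType) N (F : int -> V) : bisum N (fun j => F (- j)) = bisum N F.
Proof.
rewrite /bisum (reindex_inj rev_ord_inj) /=; apply: eq_bigr => j _; congr F.
by have := ltn_ord j; lia.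
Qed.

Section Pentagonal.
Variable R : comNzRingType.

Definition pent (i : int) : nat := jexp 1 2 i.

Lemma pentE i : (pent i)%:Z * 2 = i * (3 * i - 1).
Proof.
rewrite /pent /jexp mul1n PoszD PoszM mulrDl mulrAC -mulrA triE.
by have := triE (- i); lia.
Qed.

Lemma eulerp3 n : eulerp R 3 n *
  \prod_(i < n) ((1 - psq ^+ (3 * i + 1)) * (1 - psq ^+ (3 * i + 2))) = eulerp R 1 (3 * n).
Proof.
elim: n => [|n IH]; first by rewrite muln0 big_ord0 mulr1 !eulerp_nil.
have -> : (3 * n.+1 = (3 * n).+3)%N by lia.
rewrite !eulerpS -IH big_ord_recr /= !mul1n addn1 addn2 (_ : 3 * n.+1 = (3 * n).+3)%N; last by lia.
move: (1 - _) (1 - _) (1 - _) (eulerp _ _ _) (\prod_(i < n) _) => x y z t u.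
by ring.
Qed.

(** The triple product with a = 1, b = 2 and z = -1: E_3 supplies the factors with index divisible
    by 3, and [jprod] the other two classes. *)
Lemma pentagonal N :
  eqm N (euler R 1) (bisum N (fun i => (-1) ^+ `|i|%N * psq ^+ pent i)).
Proof.
have JTP := @triple_product R 1 2 isT N (- 1).
have sgn2 : (-1) ^+ N * (-1) ^+ N = 1 :> pser R by rewrite -exprMn mulrNN mulr1 expr1n.
have -> : bisum N (fun i => (-1) ^+ `|i|%N * psq ^+ pent i) = (-1) ^+ N * jsum 1 2 N (-1) :> pser R.
  rewrite mulr_sumr; apply: eq_bigr => j _; rewrite mulrCA mulrC -exprD; congr (_ * _).
  by rewrite -[LHS]signr_odd -[RHS]signr_odd; congr (_ ^+ _); lia.
have prodE : euler R 1 = (-1) ^+ N * ((-1) ^+ N * euler R 1) by rewrite mulrA sgn2 mul1r.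
rewrite prodE; apply: eqmM => //; apply: eqm_trans JTP.
have -> : jprod 1 2 N (-1) =
   (-1) ^+ N * \prod_(n < N) ((1 - psq ^+ (3 * n + 1)) * (1 - psq ^+ (3 * n + 2))) :> pser R.
  rewrite -[N in (-1) ^+ N]card_ord -prodr_const -big_split /=; apply: eq_bigr => n _.
  by rewrite ![(3 * n + _)%N]addnC; ring.
rewrite mulrCA; apply: eqmM => //; apply/eqm_sym.
apply: eqm_trans (eqmM (@eqm_euler R 3 N N isT _) (@eqm_refl _ _ _)) _; first by lia.
apply: eqm_trans (eqm_sym (@eqm_euler R 1 (3 * N) N isT _)); last by lia.
by rewrite eulerp3.
Qed.

End Pentagonal.

Lemma jprod10 (R : comNzRingType) N (z : pser R) :
  jprod 1 0 N z = \prod_(n < N) ((z + psq ^+ n) * (1 + z * psq ^+ n.+1)).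
Proof. by apply: eq_bigr => n _; congr ((_ + _ ^+ _) * (1 + _ * _ ^+ _)); lia. Qed.

Lemma jexp10 i : jexp 1 0 i = tri i.
Proof. by rewrite /jexp mul1n mul0n addn0. Qed.

Lemma addX1_odd (R : comNzRingType) (x : R) m :
  1 + x ^+ (2 * m).+1 = (x + 1) * \sum_(l < (2 * m).+1) (- x) ^+ l.
Proof.
have := subrX1 (- x) (2 * m).+1.
rewrite exprNn -signr_odd /= mul2n odd_double expr1 mulN1r => eqx.
by apply: oppr_inj; rewrite opprD addrC eqx -mulNr opprD addrC.
Qed.

Section JacobiCube.
Variable K : comNzRingType.

Lemma eqm_lreg (R : comNzRingType) N (a : R) (f g : pser R) :
  GRing.lreg a -> eqm N (psC a * f) (psC a * g) -> eqm N f g.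
Proof. by move=> reg fg i /fg; rewrite !coef_psCM => /reg. Qed.

(** At z = -1 the triple product reads 0 = 0 because of its factor z + 1. Taking z to be a
    polynomial variable makes z + 1 regular, so it can be cancelled from both sides before
    evaluating at -1. In the sum, the terms i and -1 - i share the exponent [tri i], and each pair
    is divisible by z + 1. *)
Lemma jacobi_cube N :
  eqm N (euler K 1 ^+ 3) (\sum_(i < N.+1) (-1) ^+ i *+ (2 * i + 1) * psq ^+ tri i).
Proof.
pose z : pser {poly K} := psC 'X.
have JTP := @triple_product _ 1 0 isT N.+1 z.
have prodE : euler {poly K} 1 * jprod 1 0 N.+1 z = psC ('X + 1) *
    (euler _ 1 * \prod_(n < N) (z + psq ^+ n.+1) * \prod_(n < N.+1) (1 + z * psq ^+ n.+1)).
  rewrite jprod10 big_split /= big_ord_recl rmorphD rmorph1 expr0 -/z.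
  under [X in _ * (_ * X * _) = _]eq_bigr => n _ do rewrite lift0.
  by rewrite -!mulrA mulrCA.
have sumE : eqm N (jsum 1 0 N.+1 z) (psC ('X + 1) *
    \sum_(i < N.+1) psq ^+ tri i * (z ^+ (N - i) * \sum_(l < (2 * i).+1) (- z) ^+ l)).
  (* The indices from -(N + 1) to N form N + 1 pairs; the unpaired last index N + 1 has exponent
     [tri] at least N and drops out. *)
  rewrite /jsum doubleS big_ord_recr /= -[X in eqm _ _ X]addr0; apply: eqmD; last first.
    apply: eqm0_qXM; rewrite jexp10.
    by have := tri_ge (N.*2.+2%:Z - N.+1%:Z); lia.
  apply: eqm_eq; rewrite (_ : N.*2.+2 = N.+1 + N.+1)%N; last by lia.
  rewrite big_split_ord /= (reindex_inj rev_ord_inj) -big_split mulr_sumr /=.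
  apply: eq_bigr => i _; have le_i : (i <= N)%N by rewrite -ltnS.
  rewrite !jexp10 subSS.
  rewrite (_ : tri ((N - i)%N%:Z - N.+1%:Z) = tri i); last first.
    by have := triE ((N - i)%N%:Z - N.+1%:Z); have := triE i%:Z; rewrite -subzn //; lia.
  rewrite (_ : (N.+1 + i)%N%:Z - N.+1%:Z = i%:Z); last by lia.
  rewrite -mulrDr [RHS]mulrCA; congr (_ * _).
  rewrite (_ : N.+1 + i = (N - i) + (2 * i).+1)%N; last by lia.
  rewrite exprD -{1}[z ^+ (N - i)]mulr1 -mulrDr mulrCA; congr (_ * _).
  have -> : psC ('X + 1) = z + 1 by rewrite rmorphD rmorph1.
  exact: addX1_odd.
have reg : GRing.lreg ('X + 1 : {poly K}).
  by have /monic_lreg := monicXaddC (1 : K); rewrite polyC1.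
have := eqm_le (leqnSn N) JTP; rewrite prodE => /eqm_trans/(_ sumE).
move=> /(eqm_lreg reg)/(eqm_map (horner_eval (-1))).
have zE : ps_map (horner_eval (-1)) z = -1.
  by rewrite ps_mapC /= horner_evalE hornerX rmorphN rmorph1.
rewrite !rmorphM !rmorph_prod rmorph_sum /= ps_map_euler.
have -> : \prod_(i < N) ps_map (horner_eval (-1 : K)) (z + psq ^+ i.+1) =
    (-1) ^+ N * eulerp K 1 N.
  rewrite eulerpE -[N in (-1) ^+ N]card_ord -prodr_const -big_split /=; apply: eq_bigr => i _.
  by rewrite rmorphD rmorphXn /= zE ps_mapq mul1n mulrBr !mulN1r opprK.
have -> : \prod_(i < N.+1) ps_map (horner_eval (-1 : K)) (1 + z * psq ^+ i.+1) =
    eulerp K 1 N.+1.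
  rewrite eulerpE; apply: eq_bigr => i _.
  by rewrite rmorphD rmorph1 rmorphM rmorphXn /= zE ps_mapq mul1n mulN1r.
have -> : \sum_(i < N.+1) ps_map (horner_eval (-1 : K)) (psq ^+ tri i *
      (z ^+ (N - i) * \sum_(l < (2 * i).+1) (- z) ^+ l)) =
    (-1) ^+ N * \sum_(i < N.+1) (-1) ^+ i *+ (2 * i + 1) * psq ^+ tri i.
  rewrite mulr_sumr; apply: eq_bigr => i _; have le_i : (i <= N)%N by rewrite -ltnS.
  rewrite !rmorphM rmorph_sum !rmorphXn /= zE ps_mapq.
  under eq_bigr => l _ do rewrite rmorphXn rmorphN /= zE opprK expr1n.
  have -> : (-1) ^+ (N - i) = (-1) ^+ N * (-1) ^+ i :> pser K.
    by rewrite -[X in _ = _ ^+ X * _](subnK le_i) exprD -mulrA -exprMn mulrNN mulr1 expr1n mulr1.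
  rewrite sumr_const card_ord addn1 -[(-1) ^+ i *+ _]mulr_natr.
  by move: (_%:R) (_ ^+ tri i) => c x; rewrite mulrC -!mulrA.
rewrite mulrCA -mulrA.
have sgn2 : (-1) ^+ N * (-1) ^+ N = 1 :> pser K by rewrite -exprMn mulrNN mulr1 expr1n.
move=> /(eqmM (@eqm_refl _ N ((-1) ^+ N))); rewrite !mulrA sgn2 !mul1r.
apply: eqm_trans; rewrite !exprS expr0 mulr1 mulrA.
by apply: eqmM; [apply: eqmM => //|]; apply: eqm_euler => //; lia.
Qed.

End JacobiCube.

(** * Dissection modulo 5 *)

Section Classes.
Variables (R : comNzRingType) (d : nat).
Implicit Types f g : pser R.

(* Homogeneous of degree [r] for the grading by exponents modulo [d]. *)
Definition ps_hom r f := forall n, n != r %[mod d] -> f n = 0.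

Lemma ps_hom_mod r r' f : r = r' %[mod d] -> ps_hom r f -> ps_hom r' f.
Proof. by move=> rr hf n; rewrite -rr; exact: hf. Qed.

Lemma ps_homD r f g : ps_hom r f -> ps_hom r g -> ps_hom r (f + g).
Proof. by move=> hf hg n nr; rewrite coef_psD hf ?hg ?addr0. Qed.

Lemma ps_homN r f : ps_hom r f -> ps_hom r (- f).
Proof. by move=> hf n nr; rewrite coef_psN hf ?oppr0. Qed.

Lemma ps_homMn r f k : ps_hom r f -> ps_hom r (f *+ k).
Proof. by move=> hf n nr; rewrite coef_psMn hf ?mul0rn. Qed.

Lemma ps_homM r s f g : ps_hom r f -> ps_hom s g -> ps_hom (r + s) (f * g).
Proof.
move=> hf hg n nrs; rewrite coef_psM big1 // => i _.
have le_in : (i <= n)%N by rewrite -ltnS.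
case: (eqVneq (i %% d)%N (r %% d)%N) => [ir|/eqP/eqP ir]; last by rewrite hf ?mul0r.
rewrite hg ?mulr0 //; apply: contra nrs => /eqP is_.
by rewrite -(subnKC le_in) -modnDm ir is_ modnDm.
Qed.

Lemma ps_hom1 : ps_hom 0 1.
Proof. by move=> n n0; rewrite coef_ps1; case: (n =P 0%N) n0 => // ->; rewrite eqxx. Qed.

Lemma ps_homX r f k : ps_hom r f -> ps_hom (r * k) (f ^+ k).
Proof.
move=> hf; elim: k => [|k IH]; first by rewrite muln0; exact: ps_hom1.
by rewrite exprS mulnS; exact: ps_homM.
Qed.

Lemma ps_homq k : ps_hom k (psq ^+ k).
Proof. by move=> n nk; rewrite coef_psqX; case: (n =P k) nk => // ->; rewrite eqxx. Qed.

Lemma ps_hom_nat k : ps_hom 0 k%:R.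
Proof. exact/ps_homMn/ps_hom1. Qed.

Lemma ps_hom_sum r I (s : seq I) (F : I -> pser R) :
  (forall i, ps_hom r (F i)) -> ps_hom r (\sum_(i <- s) F i).
Proof.
by move=> hF n nr; rewrite coef_ps_sum big1 // => i _; exact: hF.
Qed.

Lemma ps_hom_expand f : (0 < d)%N -> ps_hom 0 (ps_expand d f).
Proof. by move=> d0 n; rewrite mod0n /= /dvdn => /negPf ->. Qed.

Definition ps_contract f : pser R := Pser (fun n => f (d * n)%N).

Lemma ps_contractK f : ps_hom 0 f -> ps_expand d (ps_contract f) = f.
Proof.
move=> hf; apply: pserP => n /=; case: ifP => [dn|/negbT dn].
  by rewrite mulnC divnK.
by rewrite hf // mod0n.
Qed.

Lemma ps_homV f : (0 < d)%N -> f 0%N = 1 -> ps_hom 0 f -> ps_hom 0 (psV f).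
Proof.
move=> d0 f0 hf; have c0 : ps_contract f 0%N = 1 by rewrite /= muln0.
suff -> : psV f = ps_expand d (psV (ps_contract f)) by exact: ps_hom_expand.
apply: (psI f0); rewrite psVr // -{1}(ps_contractK hf) -ps_expandM // psVr //.
by rewrite ps_expand1.
Qed.

Definition ps_part r f : pser R := Pser (fun n => if (n == r %[mod d])%N then f n else 0).

Lemma ps_hom_part r f : ps_hom r (ps_part r f).
Proof. by move=> n /negPf /= ->. Qed.

Lemma ps_partE r f : ps_hom r f -> ps_part r f = f.
Proof. by move=> hf; apply: pserP => n /=; case: ifP => // /negbT /hf. Qed.

Lemma ps_part0 r s f : (r != s %[mod d])%N -> ps_hom s f -> ps_part r f = 0.
Proof.
move=> rs hf; apply: pserP => n /=; case: ifP => // /eqP nr; apply: hf.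
by rewrite nr.
Qed.

Lemma ps_partD r f g : ps_part r (f + g) = ps_part r f + ps_part r g.
Proof. by apply: pserP => n /=; case: ifP; rewrite ?addr0. Qed.

Lemma eqm_part N r f g : eqm N f g -> eqm N (ps_part r f) (ps_part r g).
Proof. by move=> fg n lt_nN /=; case: ifP => // _; exact: fg. Qed.

Lemma ps_dil_hom z r f : z ^+ d = 1 -> ps_hom r f -> ps_dil z f = psC (z ^+ r) * f.
Proof.
move=> zd hf; apply: pserP => n; rewrite coef_psCM coef_ps_dil.
case: (eqVneq (n %% d)%N (r %% d)%N) => [nr|nr]; last by rewrite hf ?mulr0.
by rewrite -(expr_mod _ zd) nr expr_mod.
Qed.

End Classes.

Section Dissection.
Variable K : fieldType.
Hypothesis K3 : 3%:R != 0 :> K.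
Local Notation E d := (euler K d).

(** Only the degrees 0, 1 and 2 modulo 5 occur. The class 5 i + 1 is given exactly, since it
    reproduces the whole pentagonal series at q^25. *)
Lemma pent5 i : [/\ pent (5 * i - 2) = 2 %[mod 5], pent (5 * i - 1) = 2 %[mod 5],
  pent (5 * i) = 0 %[mod 5], pent (5 * i + 1) = (25 * pent (- i) + 1)%N
  & pent (5 * i + 2) = 0 %[mod 5]].
Proof.
have h := pentE i.
have h2 : (pent (5 * i - 2))%:Z = 25 * (pent i)%:Z - 20 * i + 7.
  by have := pentE (5 * i - 2); nia.
have h1 : (pent (5 * i - 1))%:Z = 25 * (pent i)%:Z - 5 * i + 2.
  by have := pentE (5 * i - 1); nia.
have h0 : (pent (5 * i))%:Z = 25 * (pent i)%:Z + 10 * i.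
  by have := pentE (5 * i); nia.
have h3 : (pent (5 * i + 1))%:Z = 25 * (pent (- i))%:Z + 1.
  by have := pentE (5 * i + 1); have := pentE (- i); nia.
have h4 : (pent (5 * i + 2))%:Z = 25 * (pent i)%:Z + 40 * i + 5.
  by have := pentE (5 * i + 2); nia.
by split; lia.
Qed.

Let sg (i : int) : pser K := (-1) ^+ `|i|%N.

Lemma ps_hom_bisum (r : nat) N (e : int -> nat) (t : int -> int) :
  (forall i, e (t i) = r %[mod 5]) ->
  ps_hom 5 r (bisum N (fun i => sg (t i) * psq ^+ e (t i))).
Proof.
move=> he; apply: ps_hom_sum => j; apply: (@ps_hom_mod _ _ (0 + e (t (j%:Z - N%:Z)%R))).
  by rewrite add0n.
apply: ps_homM; last exact: ps_homq.
rewrite /sg -(mul0n `|t (j%:Z - N%:Z)%R|%N); apply: ps_homX.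
exact/ps_homN/ps_hom1.
Qed.

Lemma euler_parts N : exists f g, [/\ ps_hom 5 0 f, ps_hom 5 2 g &
  eqm N (E 1) (f + g - psq * E 25)].
Proof.
have [p2 p1 p0 q1 q2] : [/\ forall i, pent (5 * i - 2) = 2 %[mod 5],
    forall i, pent (5 * i - 1) = 2 %[mod 5], forall i, pent (5 * i) = 0 %[mod 5],
    forall i, pent (5 * i + 1) = (25 * pent (- i) + 1)%N
    & forall i, pent (5 * i + 2) = 0 %[mod 5]].
  by split=> i; case: (pent5 i).
exists (bisum N (fun i => sg (5 * i) * psq ^+ pent (5 * i)) +
  bisum N (fun i => sg (5 * i + 2) * psq ^+ pent (5 * i + 2))).
exists (bisum N (fun i => sg (5 * i - 2) * psq ^+ pent (5 * i - 2)) +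
  bisum N (fun i => sg (5 * i - 1) * psq ^+ pent (5 * i - 1))).
split.
- by apply: ps_homD; exact: ps_hom_bisum.
- by apply: ps_homD; exact: ps_hom_bisum.
have le_N : (N <= 5 * N + 2)%N by lia.
apply: eqm_trans (eqm_le le_N (@pentagonal K _)) _.
rewrite bisum_split5.
have -> : bisum N (fun j => (-1) ^+ `|(5 * j + 1)%R|%N * psq ^+ pent (5 * j + 1)) =
    - (psq * ps_expand 25 (bisum N (fun j => sg j * psq ^+ pent j))) :> pser K.
  rewrite -[in RHS]bisum_opp /bisum ps_expand_sum // mulr_sumr -sumrN.
  apply: eq_bigr => j _; move: (j%:Z - N%:Z) => i; rewrite q1 exprD expr1.
  rewrite ps_expandM // !ps_expandX // ps_expandN // ps_expand1 // ps_expandq // -exprM.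
  have -> : (-1) ^+ `|(5 * i + 1)%R|%N = - (-1) ^+ `|- i|%N :> pser K.
    by rewrite -[RHS]mulN1r -[RHS]exprS -[LHS]signr_odd -[RHS]signr_odd; congr (_ ^+ _); lia.
  by rewrite mulNr [psq * (_ * _)]mulrCA [_ ^+ _ * psq]mulrC.
set u2 := bisum _ _; set u1 := bisum _ _; set u0 := bisum _ _; set v := bisum _ _; set u4 := bisum _ _.
have -> : u2 + u1 + u0 - psq * ps_expand 25 v + u4 = u0 + u4 + (u2 + u1) - psq * ps_expand 25 v.
  by ring.
apply: eqmD => //; apply: eqmN; apply: eqmM => //.
rewrite -[25%N]muln1 -ps_expand_euler //; apply: eqm_expand => //.
exact/eqm_sym/pentagonal.
Qed.

Lemma ps_hom_qE25 : ps_hom 5 1 (psq * E 25).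
Proof.
rewrite -[1%N]addn0 -[psq]expr1 (_ : E 25 = ps_expand 5 (E 5)); last by rewrite ps_expand_euler.
by apply: ps_homM; [exact: ps_homq | exact: ps_hom_expand].
Qed.

Lemma euler_split : E 1 = ps_part 5 0 (E 1) - psq * E 25 + ps_part 5 2 (E 1).
Proof.
apply: eqmP => N; have [f [g [hf hg H]]] := euler_parts N.
have H0 := eqm_part 5 0 H; have H2 := eqm_part 5 2 H.
apply: eqm_trans H _; rewrite addrAC; apply: eqm_sym.
apply: eqmD; first apply: eqmD => //.
- apply: eqm_trans H0 _; rewrite !ps_partD (ps_partE hf).
  by rewrite (ps_part0 _ hg) // (ps_part0 _ (ps_homN ps_hom_qE25)) // !addr0.
- apply: eqm_trans H2 _; rewrite !ps_partD (ps_partE hg).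
  by rewrite (ps_part0 _ hf) // (ps_part0 _ (ps_homN ps_hom_qE25)) // add0r addr0.
Qed.

Lemma tri_mod5 i : tri i != 2 %[mod 5].
Proof.
apply/negP => /eqP ti; have := triE i.
have [t -> {ti}] : exists t, tri i = (5 * t + 2)%N by exists (tri i %/ 5)%N; lia.
have [m [r [-> lt_r]]] : exists m r, i = 5 * m + r /\ 0 <= r < 5.
  by exists (i %/ 5)%Z, (i %% 5)%Z; lia.
have : r = 0 \/ r = 1 \/ r = 2 \/ r = 3 \/ r = 4 by lia.
by case=> [|[|[|[|]]]] -> ; nia.
Qed.

Lemma euler_cube_part : ps_part 5 2 (E 1 ^+ 3) = 0.
Proof.
apply: eqmP => N; apply: eqm_trans (eqm_part 5 2 (@jacobi_cube K N)) _.
apply: eqm_eq; apply: pserP => n /=; case: ifP => // /eqP n2.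
rewrite coef_ps_sum big1 // => i _.
have H : ps_hom 5 (0 + tri i) ((-1) ^+ i *+ (2 * i + 1) * psq ^+ tri i : pser K).
  apply: ps_homM; last exact: ps_homq.
  by rewrite -[0%N](mul0n i); apply/ps_homMn/ps_homX/ps_homN/ps_hom1.
by apply: H; rewrite add0n n2 eq_sym tri_mod5.
Qed.

(** Let f, h, g be the components of degree 0, 1, 2 of E_1. The degree 2 component of E_1^3 is 3 f
    (f g + h^2), and it vanishes because no triangular number is 2 modulo 5. So g = - h^2 / f, and
    everything is expressed by f and k = - h / f. *)
Lemma euler_dissection : exists f k : pser K,
  [/\ ps_hom 5 0 f, ps_hom 5 1 k, f 0%N = 1, E 1 = f * (1 - k - k ^+ 2) & f * k = psq * E 25].
Proof.
set f := ps_part 5 0 (E 1); set g := ps_part 5 2 (E 1); set h := - (psq * E 25).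
have hf : ps_hom 5 0 f by exact: ps_hom_part.
have hg : ps_hom 5 2 g by exact: ps_hom_part.
have hh : ps_hom 5 1 h by exact/ps_homN/ps_hom_qE25.
have f0 : f 0%N = 1 by rewrite /= euler0.
have Es : E 1 = f + h + g by exact: euler_split.
have T : f * g + h ^+ 2 = 0.
  apply: (psI f0); rewrite mulr0.
  have homM3 a b c r (x y z : pser K) : ps_hom 5 a x -> ps_hom 5 b y -> ps_hom 5 c z ->
      a + b + c = r %[mod 5] -> ps_hom 5 r (x * y * z).
    by move=> hx hy hz /ps_hom_mod; apply; do 2?apply: ps_homM.
  have hT : ps_hom 5 2 ((f * (f * g + h ^+ 2)) *+ 3).
    rewrite expr2 mulrDr !mulrA; apply/ps_homMn/ps_homD.
      exact: (homM3 _ _ _ _ _ _ _ hf hf hg).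
    exact: (homM3 _ _ _ _ _ _ _ hf hh hh).
  have h0 : ps_hom 5 0 (f * f * f + (h * g * g) *+ 3).
    apply: ps_homD; first exact: (homM3 _ _ _ _ _ _ _ hf hf hf).
    exact/ps_homMn/(homM3 _ _ _ _ _ _ _ hh hg hg).
  have h1 : ps_hom 5 1 ((f * f * h) *+ 3 + g * g * g).
    apply: ps_homD; first exact/ps_homMn/(homM3 _ _ _ _ _ _ _ hf hf hh).
    exact: (homM3 _ _ _ _ _ _ _ hg hg hg).
  have h3 : ps_hom 5 3 (h * h * h + (f * h * g) *+ 6).
    apply: ps_homD; first exact: (homM3 _ _ _ _ _ _ _ hh hh hh).
    exact/ps_homMn/(homM3 _ _ _ _ _ _ _ hf hh hg).
  have h4 : ps_hom 5 4 ((f * g * g + h * h * g) *+ 3).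
    apply/ps_homMn/ps_homD; first exact: (homM3 _ _ _ _ _ _ _ hf hg hg).
    exact: (homM3 _ _ _ _ _ _ _ hh hh hg).
  have Ecube : E 1 ^+ 3 = (f * (f * g + h ^+ 2)) *+ 3 + (f * f * f + (h * g * g) *+ 3) +
      ((f * f * h) *+ 3 + g * g * g) + (h * h * h + (f * h * g) *+ 6) +
      (f * g * g + h * h * g) *+ 3 by rewrite Es; ring.
  have : (f * (f * g + h ^+ 2)) *+ 3 = ps_part 5 2 (E 1 ^+ 3).
    rewrite Ecube; move: (_ *+ 3) (_ + _ *+ 3) (_ *+ 3 + _) (_ + _ *+ 6) (_ *+ 3) hT h0 h1 h3 h4.
    move=> x4 x0 x1 x3 x hx h0 h1 h3 h4; rewrite 4!ps_partD (ps_partE hx).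
    by rewrite (ps_part0 _ h0) // (ps_part0 _ h1) // (ps_part0 _ h3) // (ps_part0 _ h4) // !addr0.
  rewrite euler_cube_part => T0; apply: pserP => n; apply/eqP.
  have := congr1 (fun x : pser K => x n) T0; rewrite coef_psMn -mulr_natr => /eqP.
  by rewrite mulf_eq0 (negPf K3) orbF.
have [k hk qE] : exists2 k, ps_hom 5 1 k & f * k = psq * E 25.
  exists (psV f * (psq * E 25)); last by rewrite mulrA psVr // mul1r.
  by rewrite -[1%N]add0n; apply: ps_homM ps_hom_qE25; exact: ps_homV.
exists f, k; split => //; rewrite -sqrrN opprK -qE in T; rewrite Es /h -qE.
have -> : g = - (f * k ^+ 2).
  by apply: (psI f0); apply: (addIr ((f * k) ^+ 2)); rewrite T; ring.
by ring.
Qed.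

End Dissection.

(** * Norm forms of the fifth roots of unity *)

Section Cyclotomic.
Variables (R : comNzRingType) (z : R).
Hypothesis z5 : 1 + z + z ^+ 2 + z ^+ 3 + z ^+ 4 = 0.

Lemma cyclo5_unity : z ^+ 5 = 1.
Proof.
apply/eqP; rewrite -subr_eq0; apply/eqP.
have -> : z ^+ 5 - 1 = (z - 1) * (1 + z + z ^+ 2 + z ^+ 3 + z ^+ 4) by ring.
by rewrite z5 mulr0.
Qed.

Lemma cyclo5_exp r : ~~ (5 %| r)%N ->
  1 + z ^+ r + (z ^+ r) ^+ 2 + (z ^+ r) ^+ 3 + (z ^+ r) ^+ 4 = 0.
Proof.
rewrite -(expr_mod r cyclo5_unity) /dvdn; have := ltn_pmod r (isT : 0 < 5)%N.
have e n : z ^+ (5 + n) = z ^+ n by rewrite exprD cyclo5_unity mul1r.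
case: (r %% 5)%N => [|[|[|[|[|m]]]]] // _ _; rewrite -!exprM ?expr1 //.
- rewrite -[RHS]z5 (e 1%N) (e 3%N) expr1; ring.
- rewrite -[RHS]z5 (e 1%N) (e 4%N) (e 7%N) (e 2%N) expr1; ring.
- rewrite -[RHS]z5 (e 3%N) (e 7%N) (e 2%N) (e 11%N) (e 6%N) (e 1%N) expr1; ring.
Qed.

Let a := z + z ^+ 4.
Let b := z ^+ 2 + z ^+ 3.

Let sum_ab : a + b = -1.
Proof. by apply: (addrI 1); rewrite subrr -z5 /a /b; ring. Qed.

(** Lets [ring] prove identities that hold only modulo z^5 - 1, once the cofactor w is supplied. *)
Let mod5 (y x w : R) : y = x + (z ^+ 5 - 1) * w -> y = x.
Proof. by rewrite cyclo5_unity subrr mul0r addr0. Qed.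

Let prod_ab : a * b = -1.
Proof.
by rewrite -sum_ab; apply: (@mod5 _ _ (z + z ^+ 2)); rewrite /a /b; ring.
Qed.

Lemma cyclo5_norm x y :
  (y - x) * (y - z * x) * (y - z ^+ 2 * x) * (y - z ^+ 3 * x) * (y - z ^+ 4 * x) =
  y ^+ 5 - x ^+ 5.
Proof.
have h1 : (y - z * x) * (y - z ^+ 4 * x) = y ^+ 2 - a * x * y + x ^+ 2.
  by apply: (@mod5 _ _ (x ^+ 2)); rewrite /a; ring.
have h2 : (y - z ^+ 2 * x) * (y - z ^+ 3 * x) = y ^+ 2 - b * x * y + x ^+ 2.
  by apply: (@mod5 _ _ (x ^+ 2)); rewrite /b; ring.
transitivity ((y - x) * ((y - z * x) * (y - z ^+ 4 * x)) *
  ((y - z ^+ 2 * x) * (y - z ^+ 3 * x))); first by ring.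
rewrite h1 h2; transitivity ((y - x) *
  ((y ^+ 2 + x ^+ 2) ^+ 2 - (a + b) * x * y * (y ^+ 2 + x ^+ 2) + a * b * x ^+ 2 * y ^+ 2)).
  by ring.
by rewrite sum_ab prod_ab; ring.
Qed.

(** Pairing the conjugates z, z^4 and z^2, z^3 leaves coefficients in a = z + z^4 and b = z^2 + z^3,
    the roots of x^2 + x - 1. *)
Lemma cyclo5_norm2 k :
  (1 - k - k ^+ 2) * (1 - z * k - (z * k) ^+ 2) * (1 - z ^+ 2 * k - (z ^+ 2 * k) ^+ 2) *
  (1 - z ^+ 3 * k - (z ^+ 3 * k) ^+ 2) * (1 - z ^+ 4 * k - (z ^+ 4 * k) ^+ 2) =
  1 - 11%:R * k ^+ 5 - k ^+ 10.
Proof.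
have h1 : (1 - z * k - (z * k) ^+ 2) * (1 - z ^+ 4 * k - (z ^+ 4 * k) ^+ 2) =
    1 - a * k - b * k ^+ 2 + k ^+ 2 + a * k ^+ 3 + k ^+ 4.
  apply: (@mod5 _ _ (k ^+ 2 + z * k ^+ 3 + (z ^+ 5 + 1) * k ^+ 4 + z ^+ 4 * k ^+ 3 - z ^+ 3 * k ^+ 2)).
  by rewrite /a /b; ring.
have h2 : (1 - z ^+ 2 * k - (z ^+ 2 * k) ^+ 2) * (1 - z ^+ 3 * k - (z ^+ 3 * k) ^+ 2) =
    1 - b * k - a * k ^+ 2 + k ^+ 2 + b * k ^+ 3 + k ^+ 4.
  apply: (@mod5 _ _ (k ^+ 2 - z * k ^+ 2 + (z ^+ 2 + z ^+ 3) * k ^+ 3 + (z ^+ 5 + 1) * k ^+ 4)).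
  by rewrite /a /b; ring.
transitivity ((1 - k - k ^+ 2) *
  ((1 - z * k - (z * k) ^+ 2) * (1 - z ^+ 4 * k - (z ^+ 4 * k) ^+ 2)) *
  ((1 - z ^+ 2 * k - (z ^+ 2 * k) ^+ 2) * (1 - z ^+ 3 * k - (z ^+ 3 * k) ^+ 2))); first by ring.
rewrite h1 h2; have -> : b = -1 - a by rewrite -sum_ab; ring.
have aa : a ^+ 2 = 1 - a.
  have : a * b = -1 by exact: prod_ab.
  have -> : b = -1 - a by rewrite -sum_ab; ring.
  by move=> h; apply: (addIr (a * (- 1 - a))); rewrite {2}h; ring.
apply/eqP; rewrite -subr_eq0; apply/eqP.
(* With b eliminated, the two sides differ by an explicit multiple of a^2 + a - 1. *)
transitivity ((a ^+ 2 - (1 - a)) * - (k ^+ 2 * (1 - k - k ^+ 2) ^+ 3)); first by ring.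
by rewrite aa subrr mul0r.
Qed.

End Cyclotomic.

Section Norm.
Variables (K : fieldType) (zeta : K).
Hypothesis zeta5 : 1 + zeta + zeta ^+ 2 + zeta ^+ 3 + zeta ^+ 4 = 0.
Local Notation E d := (euler K d).

(* The norm from K[[q]] to K[[q^5]]. *)
Definition ps_norm5 (f : pser K) : pser K := f * ps_dil zeta f * ps_dil (zeta ^+ 2) f *
  ps_dil (zeta ^+ 3) f * ps_dil (zeta ^+ 4) f.

Lemma ps_norm5M f g : ps_norm5 (f * g) = ps_norm5 f * ps_norm5 g.
Proof.
rewrite /ps_norm5 !rmorphM /=; move: (ps_dil _ _) (ps_dil _ _) (ps_dil _ _) (ps_dil _ _).
by move: (ps_dil _ _) (ps_dil _ _) (ps_dil _ _) (ps_dil _ _) => *; ring.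
Qed.

Lemma ps_norm5_1 : ps_norm5 1 = 1.
Proof. by rewrite /ps_norm5 !rmorph1 !mulr1. Qed.

Lemma eqm_norm5 N f g : eqm N f g -> eqm N (ps_norm5 f) (ps_norm5 g).
Proof.
have dil w : eqm N f g -> eqm N (ps_dil w f) (ps_dil w g).
  by move=> fg i lt_iN; rewrite !coef_ps_dil fg.
by move=> fg; do 4?apply: eqmM => //; exact: dil.
Qed.

Lemma ps_norm5_factor n : ps_norm5 (1 - psq ^+ n) =
  if (5 %| n)%N then (1 - psq ^+ n) ^+ 5 else 1 - psq ^+ (5 * n).
Proof.
have dilE j : ps_dil (zeta ^+ j) (1 - psq ^+ n) = 1 - psC (zeta ^+ n) ^+ j * psq ^+ n.
  by rewrite rmorphB rmorph1 /= ps_dilqX -rmorphXn exprAC.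
have dilE1 : ps_dil zeta (1 - psq ^+ n) = 1 - psC (zeta ^+ n) * psq ^+ n.
  by rewrite rmorphB rmorph1 /= ps_dilqX.
rewrite /ps_norm5 dilE1 !dilE; case: ifP => n5.
  have -> : zeta ^+ n = 1 by rewrite -(divnK n5) mulnC exprM (cyclo5_unity zeta5) expr1n.
  by rewrite rmorph1 !expr1n !mul1r !exprS expr0 mulr1 !mulrA.
have z5 : 1 + psC (zeta ^+ n) + psC (zeta ^+ n) ^+ 2 + psC (zeta ^+ n) ^+ 3 +
    psC (zeta ^+ n) ^+ 4 = 0.
  by rewrite -!rmorphXn -(rmorph1 (@psC K)) -!rmorphD (cyclo5_exp zeta5) ?n5 // rmorph0.
have := cyclo5_norm z5 (psq ^+ n) 1.
by rewrite expr1n mulnC exprM; apply.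
Qed.

(** The norm of 1 - q^n is 1 - q^(5 n) if 5 does not divide n, and (1 - q^n)^5 otherwise. The
    factors of E_25 supply the missing 1 - q^(5 n) with n divisible by 5. *)
Lemma ps_norm5_eulerp M :
  ps_norm5 (eulerp K 1 (5 * M)) * eulerp K 25 M = eulerp K 5 (5 * M) * eulerp K 5 M ^+ 5.
Proof.
elim: M => [|M IH]; first by rewrite muln0 !eulerp_nil ps_norm5_1 expr1n.
have e5 : (5 * M.+1 = (5 * M).+4.+1)%N by lia.
rewrite [eulerp K 5 M.+1]eulerpS (eulerpS _ 25) !e5 !eulerpS !ps_norm5M !mul1n !ps_norm5_factor.
have -> : (5 %| (5 * M).+1)%N = false by lia.
have -> : (5 %| (5 * M).+2)%N = false by lia.
have -> : (5 %| (5 * M).+3)%N = false by lia.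
have -> : (5 %| (5 * M).+4)%N = false by lia.
have -> : (5 %| (5 * M).+4.+1)%N by lia.
have -> : (25 * M.+1 = 5 * (5 * M).+4.+1)%N by lia.
rewrite exprMn.
move: (1 - _) (1 - _) (1 - _) (1 - _) (1 - _) (1 - _) => a b c d e f.
transitivity (ps_norm5 (eulerp K 1 (5 * M)) * eulerp K 25 M * (a * b ^+ 5 * c * d * e * f)).
  by ring.
by rewrite IH; ring.
Qed.

Lemma ps_norm5_euler : ps_norm5 (E 1) * E 25 = E 5 ^+ 6.
Proof.
apply: eqmP => N.
have E1 : eqm N (E 1) (eulerp K 1 (5 * N)) by apply: eqm_euler; lia.
have E5 : eqm N (E 5) (eulerp K 5 N) by apply: eqm_euler; lia.
have E5' : eqm N (E 5) (eulerp K 5 (5 * N)) by apply: eqm_euler; lia.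
have E25 : eqm N (E 25) (eulerp K 25 N) by apply: eqm_euler; lia.
apply: eqm_trans (eqmM (eqm_norm5 E1) E25) _.
by rewrite ps_norm5_eulerp [E 5 ^+ 6]exprS; apply/eqm_sym; apply: eqmM => //; exact: eqmX.
Qed.

Lemma euler_norm f k : ps_hom 5 0 f -> ps_hom 5 1 k -> E 1 = f * (1 - k - k ^+ 2) ->
  f ^+ 5 * (1 - 11%:R * k ^+ 5 - k ^+ 10) * E 25 = E 5 ^+ 6.
Proof.
move=> hf hk Efk; rewrite -ps_norm5_euler Efk /ps_norm5.
have u5 := cyclo5_unity zeta5.
have uX j : (zeta ^+ j) ^+ 5 = 1 by rewrite exprAC u5 expr1n.
have z5 : 1 + psC zeta + psC zeta ^+ 2 + psC zeta ^+ 3 + psC zeta ^+ 4 = 0.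
  by rewrite -!rmorphXn -(rmorph1 (@psC K)) -!rmorphD zeta5 rmorph0.
have dilE w : w ^+ 5 = 1 -> ps_dil w (f * (1 - k - k ^+ 2)) =
    f * (1 - psC w * k - (psC w * k) ^+ 2).
  move=> w5; rewrite rmorphM !rmorphB rmorph1 rmorphXn /=.
  by rewrite (ps_dil_hom w5 hf) (ps_dil_hom w5 hk) expr1 expr0 rmorph1 mul1r.
rewrite !dilE // -(cyclo5_norm2 z5) -!rmorphXn.
move: (1 - _ - _) (1 - _ - _) (1 - _ - _) (1 - _ - _) (1 - _ - _) => *.
ring.
Qed.

End Norm.

(** * The Rogers-Ramanujan parametrization *)

Section LevelFivePolynomials.
Variable R : comNzRingType.
Implicit Types k s : R.

(** Ramanujan's relation between R(q)^5 and k = R(q^5) is s = k [n5] k / [d5] k, proved in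
    [modular_equation]. [u5] is the dissection polynomial of E_1, [n5] [d5] the product of its four
    nontrivial conjugates, and the primed polynomials are derivatives. *)
Definition g5 s : R := 1 - 11%:R * s - s ^+ 2.
Definition u5 k : R := 1 - k - k ^+ 2.
Definition n5 k : R := 1 - 2%:R * k + 4%:R * k ^+ 2 - 3%:R * k ^+ 3 + k ^+ 4.
Definition d5 k : R := 1 + 3%:R * k + 4%:R * k ^+ 2 + 2%:R * k ^+ 3 + k ^+ 4.
Definition n5' k : R := - 2%:R + 8%:R * k - 9%:R * k ^+ 2 + 4%:R * k ^+ 3.
Definition d5' k : R := 3%:R + 8%:R * k + 6%:R * k ^+ 2 + 4%:R * k ^+ 3.

Lemma g5_factor k : g5 (k ^+ 5) = u5 k * (n5 k * d5 k).
Proof. by rewrite /g5 /u5 /n5 /d5; ring. Qed.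

(** Under s = k n5 / d5 this reads g5(s) d5^2 = u5^5. *)
Lemma u5_exp5 k : u5 k ^+ 5 = d5 k ^+ 2 - 11%:R * (k * n5 k) * d5 k - (k * n5 k) ^+ 2.
Proof. by rewrite /u5 /n5 /d5; ring. Qed.

(** The right-hand side is the Wronskian of k n5 and d5, so the derivative of k n5 / d5 is u5^4 /
    d5^2. *)
Lemma u5_exp4 k : u5 k ^+ 4 = (n5 k + k * n5' k) * d5 k - k * n5 k * d5' k.
Proof. by rewrite /u5 /n5 /d5 /n5' /d5'; ring. Qed.

End LevelFivePolynomials.

Section LevelFive.
Variables (K : fieldType) (zeta : K).
Hypothesis zeta5 : 1 + zeta + zeta ^+ 2 + zeta ^+ 3 + zeta ^+ 4 = 0.
Hypothesis K13 : 13%:R = 0 :> K.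
Local Notation E d := (euler K d).
Local Notation e5 := (@ps_expand K 5).

Lemma char13_nat n : (n%:R == 0 :> K) = (13 %| n)%N.
Proof. by apply/esym/(dvdn_pcharf (p := 13)); rewrite inE K13 eqxx. Qed.

Lemma ps_natI n (x y : pser K) : ~~ (13 %| n)%N -> n%:R * x = n%:R * y -> x = y.
Proof.
rewrite -char13_nat => n0 xy; apply: pserP => i.
have := congr1 (fun f : pser K => f i) xy.
by rewrite -!(rmorph_nat (@psC K)) !coef_psCM => /(mulfI n0).
Qed.

(* [s] is R(q)^5 and [k] is R(q^5) for R the Rogers-Ramanujan continued fraction; [a] is
   the weight two form with q ds/dq = s g5(s) a. *)
Lemma level5_functions : exists f k F s a : pser K,
  [/\ ps_hom 5 1 k /\ exists2 k', k = psq * k' & k' 0%N = 1,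
      exists2 s', s = psq * s' & s' 0%N = 1,
      [/\ f 0%N = 1, F 0%N = 1 & a 0%N = 1],
      [/\ f = e5 F, k ^+ 5 = e5 s & a * E 1 = F ^+ 5] &
      [/\ E 1 = f * u5 k, f * k = psq * E 25,
          f ^+ 5 * g5 (k ^+ 5) * E 25 = E 5 ^+ 6,
          F ^+ 5 * s = psq * E 5 ^+ 5 & F ^+ 5 * g5 s * E 5 = E 1 ^+ 6]].
Proof.
have K3 : 3%:R != 0 :> K by rewrite char13_nat.
have [f [k [hf hk f0 Ef fk]]] := euler_dissection K3.
have norm := euler_norm zeta5 hf hk Ef.
have E25 : E 25 = e5 (E 5) by rewrite ps_expand_euler.
have E5 : E 5 = e5 (E 1) by rewrite ps_expand_euler.
pose F := ps_contract 5 f; have fF : f = e5 F by rewrite ps_contractK.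
have F0 : F 0%N = 1 by rewrite /= muln0.
pose k' := psV f * E 25.
have kk' : k = psq * k'.
  by apply: (psI f0); rewrite fk /k' mulrCA [f * _]mulrA psVr // mul1r.
have hE25 : ps_hom 5 0 (E 25) by rewrite E25; exact: ps_hom_expand.
have hk' : ps_hom 5 0 k' by rewrite -[0%N]/(0 + 0)%N; apply: ps_homM => //; exact: ps_homV.
have k'0 : k' 0%N = 1 by rewrite coef_psM0 psV0 // mul1r euler0.
have [s sE ks] : exists2 s, s = psq * ps_contract 5 (k' ^+ 5) & k ^+ 5 = e5 s.
  exists (psq * ps_contract 5 (k' ^+ 5)); first exact: erefl.
  rewrite ps_expandM // ps_expandq // ps_contractK -?exprMn -?kk' //.
  by rewrite -(muln0 5) mulnC; exact: ps_homX.
have norm' : f ^+ 5 * g5 (k ^+ 5) * E 25 = E 5 ^+ 6 by rewrite /g5 -exprM.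
have a0 : (psV (E 1) * F ^+ 5) 0%N = 1.
  by rewrite coef_psM0 psV0 ?ps_exp0 ?euler0 // mulr1.
have aE : psV (E 1) * F ^+ 5 * E 1 = F ^+ 5.
  by rewrite mulrC mulrA psVr ?euler0 // mul1r.
have s'0 : ps_contract 5 (k' ^+ 5) 0%N = 1 by rewrite /= muln0 ps_exp0.
have Fs : F ^+ 5 * s = psq * E 5 ^+ 5.
  apply: (@ps_expand_inj _ 5) => //.
  rewrite !(ps_expandM, ps_expandX, ps_expandq) // -fF -ks -E25.
  transitivity ((f * k) ^+ 5); first by rewrite exprMn.
  by rewrite fk exprMn.
have Fgs : F ^+ 5 * g5 s * E 5 = E 1 ^+ 6.
  apply: (@ps_expand_inj _ 5) => //.
  rewrite /g5 !(ps_expandM, ps_expandX, ps_expandq, ps_expandB, ps_expand1, ps_expand_nat) //.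
  rewrite -fF -ks -E25 -E5; exact: norm'.
exists f, k, F, s, (psV (E 1) * F ^+ 5); split.
- by split; [exact: hk | exists k'].
- by exists (ps_contract 5 (k' ^+ 5)); [exact: sE | exact: s'0].
- by split; [exact: f0 | exact: F0 | exact: a0].
- by split; [exact: fF | exact: ks | exact: aE].
by split; [exact: Ef | exact: fk | exact: norm' | exact: Fs | exact: Fgs].
Qed.

End LevelFive.

Section Cancel.
Variable K : fieldType.
Hypothesis K13 : 13%:R = 0 :> K.
Implicit Types x y f u : pser K.

Lemma ps_lreg_qX m f u x y : f = psq ^+ m * u -> u 0%N = 1 -> f * x = f * y -> x = y.
Proof. by move=> -> u0; rewrite -!mulrA => /psqX_inj; exact: psI. Qed.

(** If x vanishes to order N, then x(q^5) vanishes to order 5 N and x to order 5 N - 4. This exceeds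
    N as soon as N >= 2, hence the initial condition. *)
Lemma ps_eq0_of_expand x u v :
  u 0%N = 1 -> eqm 2 x 0 -> psq ^+ 4 * u * x = v * ps_expand 5 x -> x = 0.
Proof.
move=> u0 x2 eqx; apply: eqmP => N; apply: (@eqm_le _ _ N.+2); first by lia.
elim: N => // N IH; apply: (@eqmI _ _ u) => //; rewrite mulr0.
apply: (@eqm0_qXI _ _ 4); rewrite mulrA eqx.
have := eqm_expand_mul (isT : 0 < 5)%N IH.
have -> : ps_expand 5 (0 : pser K) = 0 by apply: pserP => n /=; case: ifP.
move=> /(eqmM (@eqm_refl _ _ v)); rewrite mulr0; apply: eqm_le; lia.
Qed.

(** The constant coefficient is killed by 24, which is invertible modulo 13; every other coefficient
    is 0 or 25 times one of smaller index. *)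
Lemma ps_eq0_of_expand25 x : x = 25%:R * ps_expand 5 x -> x = 0.
Proof.
move=> eqx; apply: pserP; elim/ltn_ind => n IH.
have e : x n = 25%:R * (ps_expand 5 x) n.
  by rewrite {1}eqx -(rmorph_nat (@psC K)) coef_psCM.
case: n IH e => [|n] IH; rewrite /= => e.
  have : (25%:R - 1) * x 0%N = 0 by rewrite mulrBl mul1r -e subrr.
  rewrite -(natrB _ (isT : 1 <= 25)%N) => /eqP.
  by rewrite mulf_eq0 (char13_nat K13) => /eqP.
rewrite e; case: ifP => [d|_]; last by rewrite mulr0.
by rewrite IH ?mulr0 // ltn_divLR //; lia.
Qed.

End Cancel.

Section System.
Variables (K : fieldType) (f k F s a k' s' : pser K).
Hypothesis K13 : 13%:R = 0 :> K.
Local Notation E d := (euler K d).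
Local Notation e5 := (@ps_expand K 5).
Hypotheses (kE : k = psq * k') (k'0 : k' 0%N = 1) (sE : s = psq * s') (s'0 : s' 0%N = 1).
Hypotheses (f0 : f 0%N = 1) (F0 : F 0%N = 1) (a0 : a 0%N = 1).
Hypotheses (fF : f = e5 F) (ks : k ^+ 5 = e5 s) (aE : a * E 1 = F ^+ 5).
Hypotheses (Ef : E 1 = f * u5 k) (fk : f * k = psq * E 25).
Hypothesis norm : f ^+ 5 * g5 (k ^+ 5) * E 25 = E 5 ^+ 6.
Hypothesis Fs : F ^+ 5 * s = psq * E 5 ^+ 5.
Hypothesis Fgs : F ^+ 5 * g5 s * E 5 = E 1 ^+ 6.

Lemma coef_k0 : k 0%N = 0.
Proof. by rewrite kE coef_psM0 psq.unlock /= coefX mul0r. Qed.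
Lemma coef_s0 : s 0%N = 0.
Proof. by rewrite sE coef_psM0 psq.unlock /= coefX mul0r. Qed.

Let unit0 (x w : pser K) : x 0%N = 0 -> (1 + x * w) 0%N = 1.
Proof. by move=> x0; rewrite coef_psD coef_psM0 x0 mul0r addr0 coef_ps1. Qed.

Lemma u5_0 : u5 k 0%N = 1.
Proof.
have -> : u5 k = 1 + k * (- 1 - k) by rewrite /u5; ring.
exact/unit0/coef_k0.
Qed.
Lemma n5_0 : n5 k 0%N = 1.
Proof.
have -> : n5 k = 1 + k * (- 2%:R + 4%:R * k - 3%:R * k ^+ 2 + k ^+ 3) by rewrite /n5; ring.
exact/unit0/coef_k0.
Qed.
Lemma d5_0 : d5 k 0%N = 1.
Proof.
have -> : d5 k = 1 + k * (3%:R + 4%:R * k + 2%:R * k ^+ 2 + k ^+ 3) by rewrite /d5; ring.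
exact/unit0/coef_k0.
Qed.
Lemma g5_0 : g5 s 0%N = 1.
Proof.
have -> : g5 s = 1 + s * (- 11%:R - s) by rewrite /g5; ring.
exact/unit0/coef_s0.
Qed.

Let kI m (x y : pser K) : k ^+ m * x = k ^+ m * y -> x = y.
Proof.
by apply: (@ps_lreg_qX _ m _ (k' ^+ m)); rewrite ?kE ?exprMn ?ps_exp0.
Qed.

(** Eliminating the Euler products between the relations at q and at q^5 leaves a quadratic equation
    in s. It factors as (d5 + s k n5) (s d5 - k n5) = 0, and the first factor has constant term
    1. *)
Lemma modular_equation : s * d5 k = k * n5 k.
Proof.
have gE : g5 s * psq * E 5 ^+ 6 = s * E 1 ^+ 6.
  transitivity (psq * E 5 ^+ 5 * (g5 s * E 5)); first by ring.
  by rewrite -Fs -Fgs; ring.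
have e1 : g5 s * (k * n5 k * d5 k) = s * u5 k ^+ 5.
  apply: (psI u5_0); apply: (psI (ps_exp0 6 f0)).
  transitivity (g5 s * psq * E 5 ^+ 6).
    rewrite -norm g5_factor.
    transitivity (g5 s * f ^+ 5 * (u5 k * (n5 k * d5 k)) * (f * k)); first by ring.
    by rewrite fk; ring.
  by rewrite gE Ef; ring.
have e2 : (d5 k + s * (k * n5 k)) * (s * d5 k) = (d5 k + s * (k * n5 k)) * (k * n5 k).
  move: e1; rewrite u5_exp5 /g5; move: (k * n5 k) (d5 k) => x y e1.
  apply/eqP; rewrite -subr_eq0; apply/eqP.
  transitivity (s * (y ^+ 2 - 11%:R * x * y - x ^+ 2) - (1 - 11%:R * s - s ^+ 2) * (x * y)).
    by ring.
  by rewrite e1; ring.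
apply: psI e2; rewrite coef_psD coef_psM0 coef_s0 mul0r addr0; exact: d5_0.
Qed.

Lemma a_expand : a = e5 a * d5 k ^+ 2.
Proof.
have aE5 : e5 a * E 5 = f ^+ 5.
  by rewrite fF -ps_expandX // -aE ps_expandM // ps_expand_euler.
have as_ : s * a * E 1 = psq * E 5 ^+ 5 by rewrite -Fs -aE; ring.
have e : a * s = e5 a * (k * n5 k * d5 k).
  apply: (psI (euler0 K (isT : 0 < 5)%N)); apply: (psI f0); apply: (psI u5_0).
  transitivity (s * a * E 1 * E 5); first by rewrite Ef; ring.
  rewrite as_ -mulrA -exprSr -norm g5_factor.
  transitivity (f ^+ 5 * (u5 k * (n5 k * d5 k)) * (f * k)); first by rewrite fk; ring.
  by rewrite -aE5; ring.
apply: (psI n5_0); apply: (@kI 1); rewrite expr1.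
transitivity (a * (s * d5 k)); first by rewrite modular_equation; ring.
by rewrite mulrA e; ring.
Qed.

Let thetaE := (ps_thetaD, ps_thetaN, ps_thetaM, ps_theta_nat, ps_theta1, ps_thetaX).

Lemma theta_n5 : ps_theta (n5 k) = n5' k * ps_theta k.
Proof. by rewrite /n5 !thetaE /n5'; ring. Qed.
Lemma theta_d5 : ps_theta (d5 k) = d5' k * ps_theta k.
Proof. by rewrite /d5 !thetaE /d5'; ring. Qed.

Lemma theta_d5' : ps_theta (d5' k) = (8%:R + 12%:R * k + 12%:R * k ^+ 2) * ps_theta k.
Proof. by rewrite /d5' !thetaE; ring. Qed.
Lemma theta_u5 : ps_theta (u5 k) = (- 1 - 2%:R * k) * ps_theta k.
Proof. by rewrite /u5 !thetaE; ring. Qed.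

Lemma theta_prod4 (x y z ty tz tw w : pser K) :
  ps_theta y = ty * ps_theta x -> ps_theta z = tz * ps_theta x ->
  ps_theta w = tw * ps_theta x -> ps_theta (x * y * z * w) =
  (y * z * w + x * ty * z * w + x * y * tz * w + x * y * z * tw) * ps_theta x.
Proof. by move=> hy hz hw; rewrite !ps_thetaM hy hz hw; ring. Qed.

Let g5d : g5 s * d5 k ^+ 2 = u5 k ^+ 5.
Proof.
rewrite u5_exp5 -modular_equation /g5; move: (d5 k) => x; ring.
Qed.

Lemma theta_k5 : k ^+ 4 * ps_theta k = e5 (ps_theta s).
Proof.
apply: (@ps_natI _ K13 5) => //.
transitivity (ps_theta (k ^+ 5)); first by rewrite ps_thetaX mulr_natl.
by rewrite ks ps_theta_expand // mulr_natl.
Qed.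

(** The error Y of the equation satisfies k^4 d5^2 Y(q) = u5^4 Y(q^5), by differentiating the
    modular equation and transforming a with [a_expand]; [ps_eq0_of_expand] then applies. *)
Lemma theta_s : ps_theta s = s * g5 s * a.
Proof.
apply/eqP; rewrite -subr_eq0; apply/eqP; set Y := _ - _.
have eY : e5 Y = k ^+ 4 * ps_theta k - k ^+ 5 * g5 (k ^+ 5) * e5 a.
  rewrite theta_k5 /Y /g5 ks.
  by rewrite !(ps_expandM, ps_expandX, ps_expandq, ps_expandB, ps_expand1, ps_expand_nat).
apply: (@ps_eq0_of_expand _ Y (k' ^+ 4 * d5 k ^+ 2) (u5 k ^+ 4)).
- by rewrite coef_psM0 !ps_exp0 ?mulr1 // d5_0.
(* Order two is reached because both sides of the equation begin with q. *)
- case=> [|[|i]] // _.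
    by rewrite coef_psB coef_ps_theta !coef_psM0 coef_s0 !(mul0r, mulr0) subr0.
  have s1 x : (s * x) 1%N = s' 0%N * x 0%N.
    rewrite sE -mulrA -[psq]expr1 coef_psqXM /= coef_psM0 //.
  rewrite coef_psB coef_ps_theta -{1}[s]mulr1 s1 -mulrA s1 coef_psM0 g5_0 a0 coef_ps1.
  by rewrite !mul1r subrr.
rewrite mulrA -exprMn -kE eY.
have th : ps_theta s * d5 k + s * (d5' k * ps_theta k) = (n5 k + k * n5' k) * ps_theta k.
  rewrite -theta_d5 -ps_thetaM modular_equation ps_thetaM theta_n5; ring.
have -> : k ^+ 4 * d5 k ^+ 2 * Y = k ^+ 4 * d5 k * (ps_theta s * d5 k) -
    k ^+ 4 * (s * d5 k) * (g5 s * d5 k ^+ 2) * d5 k * e5 a.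
  by rewrite /Y {1}a_expand; ring.
have -> : ps_theta s * d5 k = (n5 k + k * n5' k) * ps_theta k - s * (d5' k * ps_theta k).
  by rewrite -th addrK.
have -> : k ^+ 4 * d5 k * ((n5 k + k * n5' k) * ps_theta k - s * (d5' k * ps_theta k)) =
    ((n5 k + k * n5' k) * d5 k - (s * d5 k) * d5' k) * (k ^+ 4 * ps_theta k) by ring.
by rewrite g5d modular_equation -u5_exp4 g5_factor; ring.
Qed.

Lemma theta_k : ps_theta k = k * g5 (k ^+ 5) * e5 a.
Proof.
apply: (@kI 4); rewrite theta_k5 theta_s ps_expandM // ps_expandM // -ks.
rewrite /g5 !(ps_expandM, ps_expandX, ps_expandq, ps_expandB, ps_expand1, ps_expand_nat) // -ks.
by ring.
Qed.

(** Here v is half the logarithmic derivative of a, an analogue of the quasimodular E_2, and its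
    equation is of Riccati type. The logarithmic derivative of [a_expand] gives v = 5 v(q^5) plus a
    multiple of a(q^5). The error Y of the Riccati equation therefore satisfies Y(q) = 25 Y(q^5). *)
Lemma theta_a : exists v, ps_theta a = 2%:R * a * v /\
  ps_theta v = v ^+ 2 + s * (3%:R + s) * g5 s * a ^+ 2.
Proof.
pose v := psC (2%:R^-1) * (psV a * ps_theta a).
have half : 2%:R * psC (2%:R^-1) = 1 :> pser K.
  by rewrite -(rmorph_nat (@psC K)) -rmorphM divff ?rmorph1 // (char13_nat K13).
have av : ps_theta a = 2%:R * a * v.
  transitivity (2%:R * psC (2%:R^-1) * (a * psV a) * ps_theta a); last by rewrite /v; ring.
  by rewrite half psVr // !mul1r.
exists v; split; first exact: av; clearbody v.
have ea0 : e5 a 0%N = 1 by rewrite coef_expand0.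
have e5nat n : e5 n%:R = n%:R by exact: ps_expand_nat.
have theta_ea : ps_theta (e5 a) = 10%:R * e5 a * e5 v.
  by rewrite ps_theta_expand // av !ps_expandM // e5nat; ring.
have vE : v = 5%:R * e5 v + k * d5' k * u5 k * n5 k * e5 a.
  apply: (psI d5_0); apply: (psI d5_0); apply: (psI ea0); apply: (@ps_natI _ K13 2) => //.
  transitivity (ps_theta a); first by rewrite av {2}a_expand; ring.
  rewrite {1}a_expand ps_thetaM theta_ea ps_thetaX theta_d5 theta_k g5_factor; ring.
pose Y x y w := x - y ^+ 2 - s * (3%:R + s) * g5 s * w ^+ 2 : pser K.
suff : Y (ps_theta v) v a = 0.
  by rewrite /Y -addrA -opprD => /eqP; rewrite subr_eq0 => /eqP.
apply: (ps_eq0_of_expand25 K13).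
have eY : e5 (Y (ps_theta v) v a) =
    e5 (ps_theta v) - e5 v ^+ 2 - k ^+ 5 * (3%:R + k ^+ 5) * g5 (k ^+ 5) * e5 a ^+ 2.
  rewrite /Y /g5 ks.
  rewrite !(ps_expandM, ps_expandX, ps_expandq, ps_expandB, ps_expandD, ps_expand1, e5nat) //.
rewrite eY {eY}.
have gs : s * (3%:R + s) * g5 s * a ^+ 2 = k * n5 k * (3%:R * d5 k + k * n5 k) * u5 k ^+ 5 * e5 a ^+ 2.
  rewrite -g5d -modular_equation {1}a_expand; ring.
have thv : ps_theta v = 25%:R * e5 (ps_theta v) +
   ps_theta (k * d5' k * u5 k * n5 k) * e5 a + k * d5' k * u5 k * n5 k * (10%:R * e5 a * e5 v).
  rewrite {1}vE ps_thetaD !(ps_thetaM _ (e5 _)) ps_theta_nat theta_ea ps_theta_expand //.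
  have gen (x y w M T : pser K) : 0 * x + 5%:R * (w *+ 5) + (T * y + M * (10%:R * y * x)) =
      25%:R * w + T * y + M * (10%:R * y * x) by ring.
  exact: gen.
rewrite /Y gs {1}thv [in v ^+ 2]vE.
have -> : ps_theta (k * d5' k * u5 k * n5 k) =
   (d5' k * u5 k * n5 k + k * (8%:R + 12%:R * k + 12%:R * k ^+ 2) * u5 k * n5 k +
    k * d5' k * (- 1 - 2%:R * k) * n5 k + k * d5' k * u5 k * n5' k) * ps_theta k.
  exact: (theta_prod4 theta_d5' theta_u5 theta_n5).
rewrite theta_k g5_factor /g5.
move: (e5 (ps_theta v)) (e5 a) (e5 v) => w x y; rewrite /d5' /u5 /n5 /n5' /d5; ring.
Qed.

End System.

(** * The Hasse invariant modulo 13 *)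

Section ListPolynomials.

(* Lists of naturals encode polynomials in s modulo 13, constant term first, so that
   polynomial identities can be decided by computation. *)
Fixpoint lp_add (l m : seq nat) : seq nat :=
  match l, m with
  | [::], _ => m
  | _, [::] => l
  | c :: l', d :: m' => ((c + d) %% 13)%N :: lp_add l' m'
  end.
Definition lp_scale c (l : seq nat) := [seq ((c * x) %% 13)%N | x <- l].
Fixpoint lp_mul (l m : seq nat) : seq nat :=
  if l is c :: l' then lp_add (lp_scale c m) (0%N :: lp_mul l' m) else [::].
(* The derivation s d/ds. *)
Fixpoint lp_der (l : seq nat) : seq nat :=
  if l is c :: l' then 0%N :: lp_add l' (lp_der l') else [::].
Fixpoint lp_eq (l m : seq nat) : bool :=
  match l, m with
  | [::], _ => all (eqn 0) m
  | _, [::] => all (eqn 0) l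
  | c :: l', d :: m' => eqn c d && lp_eq l' m'
  end.

Variables (R : comNzRingType) (s : R).
Hypothesis R13 : 13%:R = 0 :> R.

Fixpoint lp_eval (l : seq nat) : R := if l is c :: l' then c%:R + s * lp_eval l' else 0.

Let natm n : (n %% 13)%N%:R = n%:R :> R.
Proof. by rewrite [in RHS](divn_eq n 13) natrD natrM R13 mulr0 add0r. Qed.

Lemma lp_eval_add l m : lp_eval (lp_add l m) = lp_eval l + lp_eval m.
Proof.
elim: l m => [|c l IH] [|d m] /=; rewrite ?add0r ?addr0 //.
by rewrite IH natm natrD; ring.
Qed.

Lemma lp_eval_scale c l : lp_eval (lp_scale c l) = c%:R * lp_eval l.
Proof.
by elim: l => [|d l IH] /=; rewrite ?mulr0 // -/(lp_scale c l) IH natm natrM; ring.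
Qed.

Lemma lp_eval_mul l m : lp_eval (lp_mul l m) = lp_eval l * lp_eval m.
Proof.
elim: l => [|c l IH]; first by rewrite mul0r.
by rewrite /= lp_eval_add lp_eval_scale /= IH; ring.
Qed.

Lemma lp_eval_eq l m : lp_eq l m -> lp_eval l = lp_eval m.
Proof.
have zero l' : all (eqn 0) l' -> lp_eval l' = 0.
  by elim: l' => //= c l' IH /andP[/eqnP <- /IH ->]; rewrite mulr0 addr0.
elim: l m => [|c l IH] [|d m] //.
- by move=> /zero ->.
- by move=> /zero ->.
- by move=> /= /andP[/eqnP -> /IH ->].
Qed.

End ListPolynomials.

Arguments lp_mul : simpl never.
Arguments lp_add : simpl never.
Arguments lp_scale : simpl never.
Arguments lp_der : simpl never.

Section Weights.

Definition g5l := [:: 1; 2; 12]%N.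
Definition q5l := lp_mul [:: 0; 3; 1]%N g5l.

Fixpoint wl_add (l m : seq (seq nat)) :=
  match l, m with
  | c :: l', d :: m' => lp_add c d :: wl_add l' m'
  | _, _ => [::]
  end.

(* A list [l] of size n + 1 encodes the sum of the l_j(s) a^(n - j) v^j, where
   q da/dq = 2 a v; [wl_der] is q d/dq on such sums. *)
Fixpoint wl_der (l : seq (seq nat)) : seq (seq nat) :=
  if l is c :: l' then
    wl_add (wl_add (lp_mul g5l (lp_der c) :: wl_der l')
                   ([::] :: lp_scale (2 * size l') c :: l'))
           (map (lp_mul q5l) l' ++ [:: [::]; [::]])
  else [:: [::]].

Lemma wl_der_cons c l : wl_der (c :: l) =
  wl_add (wl_add (lp_mul g5l (lp_der c) :: wl_der l) ([::] :: lp_scale (2 * size l) c :: l))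
         (map (lp_mul q5l) l ++ [:: [::]; [::]]).
Proof. by []. Qed.

Definition wl_step l := wl_add (map (lp_mul g5l) l ++ [:: [::]]) (wl_der l).

Lemma size_wl_add l m : size l = size m -> size (wl_add l m) = size l.
Proof. by elim: l m => [|c l IH] [|d m] //= [/IH ->]. Qed.

Lemma size_wl_der l : size (wl_der l) = (size l).+1.
Proof.
elim: l => // c l IH; rewrite wl_der_cons.
have e : size (wl_add (lp_mul g5l (lp_der c) :: wl_der l)
    ([::] :: lp_scale (2 * size l) c :: l)) = (size l).+2.
  by rewrite size_wl_add /= IH.
by rewrite size_wl_add e // size_cat size_map addn2.
Qed.

Variable K : fieldType.
Variables s a v : pser K.
Hypothesis K13 : 13%:R = 0 :> K.
Hypotheses (theta_s : ps_theta s = s * g5 s * a) (theta_a : ps_theta a = 2%:R * a * v)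
  (theta_v : ps_theta v = v ^+ 2 + s * (3%:R + s) * g5 s * a ^+ 2).

Let ps13 : 13%:R = 0 :> pser K.
Proof. by rewrite -(rmorph_nat (@psC K)) K13 rmorph0. Qed.

Local Notation ev := (lp_eval s).

Lemma lp_eval_g5 : ev g5l = g5 s.
Proof.
have -> : g5 s = ev g5l - 13%:R * (s + s ^+ 2) by rewrite /g5 /=; ring.
by rewrite ps13 mul0r subr0.
Qed.

Lemma lp_eval_q5 : ev q5l = s * (3%:R + s) * g5 s.
Proof. by rewrite /q5l (lp_eval_mul _ ps13) lp_eval_g5 /=; ring. Qed.

Lemma theta_aX n : ps_theta (a ^+ n) = (2 * n)%:R * v * a ^+ n.
Proof.
case: n => [|n]; first by rewrite ps_theta1 muln0 !mul0r.
by rewrite ps_thetaX theta_a -mulr_natr natrM exprS; ring.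
Qed.

Lemma theta_lp_eval l : ps_theta (ev l) = ev (lp_der l) * (g5 s * a).
Proof.
elim: l => [|c l IH] /=; first by rewrite mul0r; apply: pserP => n /=; rewrite mulr0.
rewrite ps_thetaD ps_theta_nat ps_thetaM IH theta_s (lp_eval_add _ ps13); ring.
Qed.

Fixpoint wl_eval (l : seq (seq nat)) : pser K :=
  if l is c :: l' then ev c * a ^+ size l' + v * wl_eval l' else 0.

Lemma wl_eval_add l m : size l = size m -> wl_eval (wl_add l m) = wl_eval l + wl_eval m.
Proof.
elim: l m => [|c l IH] [|d m] //=; first by rewrite addr0.
by move=> [eq_lm]; rewrite IH // (lp_eval_add _ ps13) size_wl_add // eq_lm; ring.
Qed.

Lemma wl_eval_rcons l : wl_eval (rcons l [::]) = a * wl_eval l.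
Proof.
elim: l => [|c l IH] /=; first by rewrite !mulr0 mul0r addr0.
by rewrite IH size_rcons exprS; ring.
Qed.

Lemma wl_eval_map p l : wl_eval (map (lp_mul p) l) = ev p * wl_eval l.
Proof.
elim: l => [|c l IH] /=; first by rewrite mulr0.
by rewrite IH size_map (lp_eval_mul _ ps13); ring.
Qed.

Lemma theta_wl_eval l : ps_theta (wl_eval l) = wl_eval (wl_der l).
Proof.
elim: l => [|c l IH].
  by rewrite /= !mulr0 mul0r addr0; apply: pserP => n /=; rewrite mulr0.
have sz := size_wl_der l.
rewrite wl_der_cons wl_eval_add; last first.
  by rewrite size_wl_add /= sz // size_cat size_map addn2.
rewrite wl_eval_add; last by rewrite /= sz.
have -> : map (lp_mul q5l) l ++ [:: [::]; [::]] = rcons (rcons (map (lp_mul q5l) l) [::]) [::].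
  by rewrite -!cats1 -catA.
rewrite !wl_eval_rcons wl_eval_map lp_eval_q5 /= sz (lp_eval_mul _ ps13) lp_eval_g5.
rewrite (lp_eval_scale _ ps13) -IH ps_thetaD !ps_thetaM theta_aX theta_lp_eval theta_v.
rewrite !(exprS a (size l)); move: (ps_theta (wl_eval l)) (wl_eval l) => y z.
move: ((2 * size l)%:R) (g5 s) (ev c) (ev (lp_der c)) (a ^+ size l) => *; ring.
Qed.

Definition wl_iter n := iter n wl_step [:: [:: 1%N]].

Lemma theta_iter n : iter n (@ps_theta K) s = s * wl_eval (wl_iter n).
Proof.
elim: n => [|n IH]; first by rewrite /=; ring.
rewrite iterS IH ps_thetaM theta_wl_eval theta_s /wl_iter iterS -/(wl_iter n) /wl_step.
rewrite wl_eval_add; last by rewrite size_cat size_map size_wl_der addn1.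
by rewrite cats1 wl_eval_rcons wl_eval_map lp_eval_g5; ring.
Qed.

End Weights.

(* (g^2 + 3 s g + 5 s^2)^3 - 5 s g^5 modulo 13, where g = 1 - 11 s - s^2: the square root
   found in the 13th iterate of q d/dq on s. *)
Definition hasse5l := [:: 1; 3; 6; 4; 3; 8; 10; 5; 3; 9; 6; 10; 1]%N.

(** Modulo 13 all terms with a positive power of v disappear, so the iterate is a polynomial in s
    times a^13; that polynomial is g5 times a perfect square. *)
Lemma wl_iter13 : let l := wl_iter 13 in
  [&& size l == 14, lp_eq (head [::] l) (lp_mul g5l (lp_mul hasse5l hasse5l))
    & all (fun c => lp_eq c [::]) (behead l)].
Proof. by vm_compute. Qed.

Section Hasse.
Variable K : fieldType.
Hypothesis K13 : 13%:R = 0 :> K.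

Lemma iter_theta13 (f : pser K) : iter 13 (@ps_theta K) f = ps_theta f.
Proof.
have pK : 13%N \in [pchar K] by rewrite inE K13 eqxx.
apply: pserP => n; have it m : iter m (@ps_theta K) f n = n%:R ^+ m * f n.
  by elim: m => [|m IH]; rewrite ?expr0 ?mul1r // iterS coef_ps_theta IH exprS mulrA.
by rewrite it coef_ps_theta -(pFrobenius_autE pK) rmorph_nat.
Qed.

Variables (s a v s' : pser K).
Hypotheses (sE : s = psq * s') (s'0 : s' 0%N = 1) (a0 : a 0%N = 1).
Hypotheses (theta_s : ps_theta s = s * g5 s * a) (theta_a : ps_theta a = 2%:R * a * v)
  (theta_v : ps_theta v = v ^+ 2 + s * (3%:R + s) * g5 s * a ^+ 2).

Let ps13 : 13%:R = 0 :> pser K.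
Proof. by rewrite -(rmorph_nat (@psC K)) K13 rmorph0. Qed.

(* [ps_theta] is its own 13th iterate, while iterating the differential equations of [s],
   [a] and [v] multiplies [ps_theta s] by the square of the left-hand side. *)
Lemma hasse_invariant : a ^+ 6 * lp_eval s hasse5l = 1.
Proof.
set x := a ^+ 6 * _.
have zeros (l : seq (seq nat)) : all (fun c => lp_eq c [::]) l -> wl_eval s a v l = 0.
  by elim: l => //= c l IH /andP[/(lp_eval_eq s) -> /IH ->]; rewrite mul0r mulr0 addr0.
have := theta_iter K13 theta_s theta_a theta_v 13.
have := wl_iter13; cbv zeta; move: (wl_iter 13) => W /and3P[szW hd tl].
have ev13 : wl_eval s a v W = g5 s * lp_eval s hasse5l ^+ 2 * a ^+ 13.
  case: W szW hd tl => // c l /eqP[szl] /(lp_eval_eq s) hd /zeros tl.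
  rewrite /= tl szl hd !(lp_eval_mul _ ps13) (lp_eval_g5 _ K13) mulr0 addr0 -expr2.
  reflexivity.
rewrite iter_theta13 ev13 theta_s -mulrA sE -!mulrA => /psq_inj/(psI s'0).
rewrite -sE => /(psI (g5_0 sE)) => e.
have x2 : x * x = 1.
  apply: (psI a0); rewrite mulr1 [RHS]e /x; ring.
have x0 : x 0%N = 1.
  rewrite coef_psM0 ps_exp0 // mul1r -[lp_eval _ _]/(1 + s * lp_eval s (behead hasse5l)).
  by rewrite coef_psD coef_psM0 (coef_s0 sE) mul0r addr0 coef_ps1.
have half : 2%:R * psC (2%:R^-1) = 1 :> pser K.
  by rewrite -(rmorph_nat (@psC K)) -rmorphM divff ?rmorph1 // (char13_nat K13).
(* From x^2 = 1 alone the sign of x is undetermined; the constant term 1 makes (x + 1) / 2 a unit,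
   which leaves x = 1. *)
have u0 : (1 + psC (2%:R^-1) * (x - 1)) 0%N = 1.
  by rewrite coef_psD coef_psCM coef_psB x0 coef_ps1 subrr mulr0 addr0.
apply/eqP; rewrite -subr_eq0; apply/eqP/(psI u0); rewrite mulr0.
transitivity (psC (2%:R^-1) * (x * x - 1) + (1 - 2%:R * psC (2%:R^-1)) * (x - 1)); first by ring.
by rewrite x2 half !subrr mulr0 mul0r addr0.
Qed.

End Hasse.

(** * Coefficients with index divisible by 5 *)

Section ListClasses.
Variables (R : comNzRingType) (k : pser R).
Hypothesis hk : ps_hom 5 1 k.

Lemma ps_partM0 d r (h x : pser R) : ps_hom d 0 h -> ps_part d r (h * x) = h * ps_part d r x.
Proof.
move=> hh; apply: pserP => n; rewrite coef_psM /= coef_psM.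
have hn (i : 'I_n.+1) : (i = 0 %[mod d])%N -> (n - i = n %[mod d])%N.
  move=> i0; have := modnDml i (n - i) d.
  by rewrite i0 mod0n add0n subnKC // -ltnS.
have hi (i : 'I_n.+1) y : ((i = 0 %[mod d])%N -> y = 0) -> h i * y = 0.
  case: (eqVneq (i %% d)%N (0 %% d)%N) => [i0 -> //|i0 _]; first by rewrite mulr0.
  by rewrite hh ?mul0r.
case: ifP => [/eqP nr|/negbT nr].
  apply: eq_bigr => i _ /=; case: ifP => // /negbT ir; rewrite mulr0; apply: hi => i0.
  by rewrite hn // nr eqxx in ir.
rewrite big1 // => i _; apply: hi => i0 /=.
by rewrite hn // (negPf nr).
Qed.

Fixpoint lp_fifth (l : seq nat) : seq nat :=
  match l with
  | [:: c, _, _, _, _ & l'] => c :: lp_fifth l'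
  | c :: _ => [:: c]
  | [::] => [::]
  end.

Lemma ps_part_lp_eval l : ps_part 5 0 (lp_eval k l) = lp_eval (k ^+ 5) (lp_fifth l).
Proof.
have h0 : ps_hom 5 0 (k ^+ 5) by exact: (@ps_hom_mod _ 5 (1 * 5) 0 _ erefl (ps_homX hk)).
have key c0 c1 c2 c3 c4 x : ps_part 5 0 (c0%:R + k * (c1%:R + k * (c2%:R + k * (c3%:R +
    k * (c4%:R + k * x))))) = c0%:R + k ^+ 5 * ps_part 5 0 x.
  transitivity (ps_part 5 0 (c0%:R + (k ^+ 1 * c1%:R + (k ^+ 2 * c2%:R + (k ^+ 3 * c3%:R +
    (k ^+ 4 * c4%:R + k ^+ 5 * x)))))).
    by congr ps_part; ring.
  rewrite 5!ps_partD (ps_partM0 _ _ h0) (ps_partE (@ps_hom_nat R 5 c0)).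
  have z (i c : nat) : (0 < i < 5)%N -> ps_part 5 0 (k ^+ i * c%:R) = 0.
    move=> i5; apply: (@ps_part0 _ _ _ (1 * i + 0)).
      by rewrite mul1n addn0 mod0n eq_sym modn_small; lia.
    by apply: ps_homM; [exact: ps_homX | exact: ps_hom_nat].
  by rewrite !z // !add0r.
have part_0 : ps_part 5 0 (0 : pser R) = 0 by apply: pserP => n /=; case: ifP.
elim: {l}(size l).+1 {-2}l (ltnSn (size l)) => // m IH.
case=> [|c0 [|c1 [|c2 [|c3 [|c4 l]]]]] lt_m; rewrite /=.
- exact: part_0.
- by have := key c0 0%N 0%N 0%N 0%N 0; rewrite part_0 !(mulr0, addr0).
- by have := key c0 c1 0%N 0%N 0%N 0; rewrite part_0 !(mulr0, addr0).
- by have := key c0 c1 c2 0%N 0%N 0; rewrite part_0 !(mulr0, addr0).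
- by have := key c0 c1 c2 c3 0%N 0; rewrite part_0 !(mulr0, addr0).
- by rewrite key IH //; move: lt_m => /=; lia.
Qed.

End ListClasses.

Lemma ps_expand_contract (R : comNzRingType) d (f : pser R) :
  ps_expand d (ps_contract d f) = ps_part d 0 f.
Proof.
apply: pserP => n /=; rewrite mod0n -/(d %| n)%N; case: ifP => // dn.
by rewrite mulnC divnK.
Qed.

Lemma ps_expand_lp_eval (R : comNzRingType) d (x : pser R) l : (0 < d)%N ->
  ps_expand d (lp_eval x l) = lp_eval (ps_expand d x) l.
Proof.
move=> d0; elim: l => [|c l IH] /=; first by apply: pserP => n /=; case: ifP.
by rewrite ps_expandD // ps_expandM // ps_expand_nat // IH.
Qed.

Definition nd5l := lp_mul [:: 1; 11; 4; 10; 1]%N [:: 1; 3; 4; 2; 1]%N.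
(** The polynomial k (n5 d5)^6 that [progression5] subtracts from g5(k^5)^5. Keeping the powers of
    k^5 = s(q^5) turns it into [watsonl], a polynomial in s. *)
Definition ramanujanl :=
  0%N :: lp_mul (lp_mul nd5l (lp_mul nd5l nd5l)) (lp_mul nd5l (lp_mul nd5l nd5l)).
Definition watsonl := lp_fifth ramanujanl.
Definition g5X5l := lp_mul (lp_mul g5l g5l) (lp_mul g5l (lp_mul g5l g5l)).

(* The congruence rests on this coincidence: modulo 13, s times the numerator of the
   dissection agrees with the Hasse polynomial up to terms divisible by g^5. *)
Lemma watson_hasse :
  lp_eq (lp_add (0%N :: g5X5l) hasse5l)
    (lp_add (lp_mul (lp_add [:: 0; 5]%N g5l) g5X5l) (0%N :: watsonl)).
Proof. by vm_compute. Qed.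

Section ListPolynomialValues.
Variables (R : comNzRingType) (x : R).
Hypothesis R13 : 13%:R = 0 :> R.

Lemma lp_eval_cons c l : lp_eval x (c :: l) = c%:R + x * lp_eval x l.
Proof. by []. Qed.

Lemma lp_eval_ramanujan : lp_eval x ramanujanl = x * (n5 x * d5 x) ^+ 6.
Proof.
have e : lp_eval x nd5l = n5 x * d5 x.
  rewrite (lp_eval_mul _ R13); congr (_ * _); last by rewrite /d5 /=; ring.
  rewrite -[RHS]addr0 -(mul0r (x + x ^+ 3)) -R13 /n5 /=; ring.
rewrite /ramanujanl lp_eval_cons add0r (lp_eval_mul _ R13) (lp_eval_mul _ R13 nd5l).
by rewrite (lp_eval_mul _ R13 nd5l nd5l) e; ring.
Qed.

Lemma lp_eval_watson : x * g5 x ^+ 5 + lp_eval x hasse5l =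
  (5%:R * x + g5 x) * g5 x ^+ 5 + x * lp_eval x watsonl.
Proof.
have e : lp_eval x g5l = g5 x.
  by rewrite -[RHS]addr0 -(mul0r (x + x ^+ 2)) -R13 /g5 /=; ring.
have e5 : lp_eval x g5X5l = g5 x ^+ 5.
  rewrite /g5X5l (lp_eval_mul _ R13) (lp_eval_mul _ R13 g5l (lp_mul _ _)).
  by rewrite !(lp_eval_mul _ R13 g5l g5l) e; ring.
have l := lp_eval_add x R13 (0%N :: g5X5l) hasse5l.
have r := lp_eval_add x R13 (lp_mul (lp_add [:: 0; 5]%N g5l) g5X5l) (0%N :: watsonl).
have r1 := lp_eval_mul x R13 (lp_add [:: 0; 5]%N g5l) g5X5l.
have r2 : lp_eval x (lp_add [:: 0; 5]%N g5l) = 5%:R * x + g5 x.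
  by rewrite (lp_eval_add x R13) e lp_eval_cons /= mulr0 addr0 add0r mulrC.
have c l' : lp_eval x (0%N :: l') = x * lp_eval x l' by rewrite lp_eval_cons add0r.
rewrite (c g5X5l) e5 in l; rewrite r1 r2 e5 (c watsonl) in r.
exact: etrans (esym l) (etrans (lp_eval_eq x watson_hasse) r).
Qed.

End ListPolynomialValues.

Section Progression.
Variable K : fieldType.
Variable zeta : K.
Hypothesis K13 : 13%:R = 0 :> K.
Hypothesis zeta5 : 1 + zeta + zeta ^+ 2 + zeta ^+ 3 + zeta ^+ 4 = 0.
Local Notation E d := (euler K d).
Local Notation e5 := (@ps_expand K 5).

Let ps13 : 13%:R = 0 :> pser K.
Proof. by rewrite -(rmorph_nat (@psC K)) K13 rmorph0. Qed.

Lemma progression5 (C : pser K) : C * E 1 ^+ 6 * E 5 = E 1 ^+ 6 + 25%:R * (psq * E 5 ^+ 6) ->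
  ps_contract 5 C * psq * E 1 ^+ 25 * E 5 ^+ 6 =
  5%:R * psq * E 1 ^+ 24 * E 5 ^+ 6 + E 1 ^+ 30 - E 5 ^+ 6.
Proof.
have [f [k [F [s [a [[hk [k' kE k'0]] [s' sE s'0] [f0 F0 a0] [fF ks aE] [Ef fk norm Fs Fgs]]]]]]] :=
  level5_functions zeta5 K13.
move=> CE.
have th_s := theta_s K13 kE k'0 sE f0 a0 fF ks aE Ef fk norm Fs Fgs.
have [v [th_a th_v]] := theta_a K13 kE k'0 sE f0 a0 fF ks aE Ef fk norm Fs Fgs.
have hasse := hasse_invariant K13 sE s'0 a0 th_s th_a th_v.
have E0 d : (0 < d)%N -> E d 0%N = 1 by exact: euler0.
have u0 := u5_0 kE.
pose G := g5 (k ^+ 5); have GE : G = u5 k * (n5 k * d5 k) by exact: g5_factor.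
have qE5 : psq * E 5 ^+ 6 = f ^+ 6 * k * G.
  by rewrite -norm -/G; transitivity (f ^+ 5 * G * (f * k)); [rewrite fk|]; ring.
have m25 : 25%:R = -1 :> pser K.
  by have -> : 25%:R = 13%:R * 2%:R - 1 :> pser K; [ring | rewrite ps13 mul0r sub0r].
(* Dividing by f^6 leaves the denominator u5(k)^5. Multiplying by the fifth power of its conjugates
   n5 d5 makes it g5(k^5)^5, a series in q^5, so that taking components modulo 5 only affects the
   numerator. *)
have CG : C * E 5 * G ^+ 5 = G ^+ 5 - k * (n5 k * d5 k) ^+ 6.
  apply: (psI u0); apply: (psI (ps_exp0 6 f0)); apply: (psI (ps_exp0 5 u0)).
  transitivity (C * (f * u5 k) ^+ 6 * E 5 * G ^+ 5); first by ring.
  rewrite -Ef CE m25 qE5 Ef.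
  have -> : G ^+ 5 = u5 k ^+ 5 * (n5 k * d5 k) ^+ 5 by rewrite GE exprMn.
  rewrite GE; move: (n5 k * d5 k) => w; ring.
have DG : ps_contract 5 C * E 1 * g5 s ^+ 5 = g5 s ^+ 5 - lp_eval s watsonl.
  apply: (@ps_expand_inj _ 5) => //.
  have e5G : e5 (g5 s) = G.
    rewrite /G /g5 ks.
    by rewrite !(ps_expandM, ps_expandX, ps_expandq, ps_expandB, ps_expand1, ps_expand_nat).
  have hG : ps_hom 5 0 G by rewrite -e5G; exact: ps_hom_expand.
  have hGX : ps_hom 5 0 (G ^+ 5) by have := @ps_homX _ 5 0 _ 5 hG; rewrite mul0n.
  have E5 : E 5 = e5 (E 1) by rewrite ps_expand_euler.
  have hEG : ps_hom 5 0 (E 5 * G ^+ 5).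
    rewrite -[0%N]/(0 + 0)%N; apply: ps_homM hGX; rewrite E5; exact: ps_hom_expand.
  have e5X : e5 (g5 s ^+ 5) = G ^+ 5 by rewrite ps_expandX // e5G.
  rewrite [LHS]ps_expandM // [e5 (_ * E 1)]ps_expandM // [RHS]ps_expandB // e5X -E5.
  rewrite ps_expand_contract ps_expand_lp_eval // -ks /watsonl -(ps_part_lp_eval hk).
  rewrite -mulrA mulrC -(ps_partM0 _ _ hEG) mulrC mulrA CG (lp_eval_ramanujan _ ps13).
  by rewrite ps_partD (ps_partE hGX); congr (_ + _); apply: pserP => n /=; case: ifP; rewrite ?oppr0.
have gE : s * E 1 ^+ 6 = g5 s * (psq * E 5 ^+ 6).
  by rewrite -Fgs; transitivity (g5 s * (F ^+ 5 * s) * E 5); [|rewrite Fs]; ring.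
have asE : a * s * E 1 = psq * E 5 ^+ 5 by rewrite -Fs -aE; ring.
have agE : a * g5 s * E 5 = E 1 ^+ 5.
  by apply: (psI (E0 1%N isT)); transitivity (F ^+ 5 * g5 s * E 5); [rewrite -aE|rewrite Fgs]; ring.
have ag6 : s * g5 s ^+ 5 * a ^+ 6 = psq * E 1 ^+ 24.
  apply: (psI (E0 1%N isT)); apply: (psI (ps_exp0 5 (E0 5%N isT))).
  transitivity ((a * g5 s * E 5) ^+ 5 * (a * s * E 1)); first by ring.
  by rewrite agE asE; ring.
have ag30 : g5 s ^+ 6 * a ^+ 6 * E 5 ^+ 6 = E 1 ^+ 30.
  by transitivity ((a * g5 s * E 5) ^+ 6); [|rewrite agE]; ring.
have addE (x y z : pser K) : x + y = z -> y = z - x by move=> <-; rewrite addrC addKr.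
have W := lp_eval_watson s ps13.
(* After multiplication by s a^6 the numerator is replaced by means of [lp_eval_watson]. The Hasse
   polynomial then occurs only as a^6 H(s), which is 1. *)
have key : ps_contract 5 C * E 1 * (s * g5 s ^+ 5 * a ^+ 6) =
    5%:R * (s * g5 s ^+ 5 * a ^+ 6) + g5 s ^+ 6 * a ^+ 6 - a ^+ 6 * lp_eval s hasse5l.
  transitivity (s * a ^+ 6 * (ps_contract 5 C * E 1 * g5 s ^+ 5)); first by ring.
  rewrite DG.
  have -> : lp_eval s hasse5l = (5%:R * s + g5 s) * g5 s ^+ 5 + s * lp_eval s watsonl - s * g5 s ^+ 5.
    exact: addE W.
  by move: (lp_eval s watsonl) (g5 s) => *; ring.
transitivity (ps_contract 5 C * E 1 * (s * g5 s ^+ 5 * a ^+ 6) * E 5 ^+ 6); first by rewrite ag6; ring.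
by rewrite key hasse -ag30 ag6; ring.
Qed.

End Progression.

(** * Vanishing of the coefficients in the twelve progressions *)

Section Vanishing.
Variable K : fieldType.
Variable zeta : K.
Hypothesis K13 : 13%:R = 0 :> K.
Hypothesis zeta5 : 1 + zeta + zeta ^+ 2 + zeta ^+ 3 + zeta ^+ 4 = 0.
Local Notation E d := (euler K d).

Lemma euler_exp13 : E 1 ^+ 13 = E 13.
Proof.
have p13 : 13%N \in [pchar (pser K)].
  by apply/andP; split=> //; rewrite -(rmorph_nat (@psC K)) K13 rmorph0.
apply: eqmP => N.
have E1 : eqm N (E 1) (eulerp K 1 N) by apply: eqm_euler; lia.
have E13 : eqm N (E 13) (eulerp K 13 N) by apply: eqm_euler; lia.
apply: eqm_trans (eqmX 13 E1) _; apply: eqm_trans _ (eqm_sym E13); apply: eqm_eq.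
rewrite !eulerpE -(pFrobenius_autE p13) rmorph_prod; apply: eq_bigr => i _.
by rewrite rmorphB rmorph1 /= pFrobenius_autE -exprM mul1n mulnC.
Qed.

Lemma pent_mod13 i : (pent i %% 13)%N \in [:: 0; 1; 2; 5; 7; 9; 12]%N.
Proof.
have := pentE i.
have [m [r [-> lt_r]]] : exists m r, i = 13 * m + r /\ 0 <= r < 13.
  by exists (i %/ 13)%Z, (i %% 13)%Z; lia.
move: (pent _) => p hp; have {hp} [t hp] : exists t, p%:Z * 2 = 13 * t + r * (3 * r - 1).
  by exists (39 * m * m + 6 * m * r - m); rewrite hp; ring.
have : r = 0 \/ r = 1 \/ r = 2 \/ r = 3 \/ r = 4 \/ r = 5 \/ r = 6 \/ r = 7 \/ r = 8 \/
  r = 9 \/ r = 10 \/ r = 11 \/ r = 12 by lia.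
rewrite !inE; move: hp => /[swap].
by do 12?[case=> [->|]; first by lia]; move=> ->; lia.
Qed.

Lemma coef_euler_mod13 n : (n %% 13)%N \notin [:: 0; 1; 2; 5; 7; 9; 12]%N -> E 1 n = 0.
Proof.
move=> nr; rewrite (@pentagonal K n.+1) // /bisum coef_ps_sum big1 // => j _.
set i := _ - _.
have H : ps_hom 13 (0 + pent i) ((-1) ^+ `|i|%N * psq ^+ pent i : pser K).
  apply: ps_homM; last exact: ps_homq.
  by rewrite -[0%N](mul0n `|i|%N); apply/ps_homX/ps_homN/ps_hom1.
by apply: H; apply: contra nr => /eqP ->; rewrite add0n pent_mod13.
Qed.

Lemma vanishing (C : pser K) m :
  C * E 1 ^+ 6 * E 5 = E 1 ^+ 6 + 25%:R * (psq * E 5 ^+ 6) ->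
  (m %% 5)%N \in [:: 0; 3]%N -> (m %% 13)%N \in [:: 2; 3; 5; 7; 9; 10]%N -> C (5 * m)%N = 0.
Proof.
move=> CE m5 m13; have prog := progression5 K13 zeta5 CE.
have [f [k [F [s [a [[hk _] _ [f0 F0 a0] [fF _ _] [Ef fk norm _ _]]]]]]] :=
  level5_functions zeta5 K13.
have E10 := euler0 K (isT : 0 < 1)%N; have E50 := euler0 K (isT : 0 < 5)%N.
have E130 := euler0 K (isT : 0 < 13)%N.
have E1V := psVr E10; have E5V := psVr E50; have E13V := psVr E130.
move: (psV0 E130) E1V E5V E13V.
have hV5 : ps_hom 5 0 (psV (E 5)).
  apply: ps_homV => //; rewrite -[5%N]muln1 -ps_expand_euler //; exact: ps_hom_expand.
have hV13 : ps_hom 13 0 (psV (E 13)).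
  apply: ps_homV => //; rewrite -[13%N]muln1 -ps_expand_euler //; exact: ps_hom_expand.
move: (psV (E 1)) (psV (E 5)) (psV (E 13)) hV5 hV13 => V1 V5 V13 hV5 hV13 _ E1V E5V E13V.
pose W := 5%:R * psq * V1 + E 1 ^+ 5 * V5 ^+ 6.
(* The identity of [progression5] divided by E_1^25 E_5^6, with E_1^(-25) written as E_1 /
   E_13^2. *)
have qD : psq * ps_contract 5 C = W - E 1 * V13 ^+ 2.
  apply: (psI (ps_exp0 25 E10)); apply: (psI (ps_exp0 6 E50)).
  transitivity (ps_contract 5 C * psq * E 1 ^+ 25 * E 5 ^+ 6); first by ring.
  rewrite prog; transitivity (5%:R * psq * (E 1 * V1) * E 1 ^+ 24 * E 5 ^+ 6 +
    E 1 ^+ 30 * (E 5 * V5) ^+ 6 - (E 1 ^+ 13) ^+ 2 * V13 ^+ 2 * E 5 ^+ 6).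
    by rewrite E1V E5V euler_exp13 -exprMn E13V; ring.
  by rewrite /W; ring.
(* This is u5(k)^5 + 5 k n5(k) d5(k), expanded: the powers 1, 4, 6 and 9 of k cancel, so no exponent
   is 1 or 4 modulo 5. These are the residues of m + 1. *)
pose p : pser K := 1 + k ^+ 2 * 10%:R + k ^+ 3 * 20%:R + k ^+ 5 * 14%:R + k ^+ 7 * 20%:R +
    k ^+ 8 * - 10%:R + k ^+ 10 * - 1%:R.
have WE : W = V5 ^+ 6 * f ^+ 5 * p.
  have qE5 : psq * E 5 ^+ 6 = f ^+ 6 * k * g5 (k ^+ 5).
    by rewrite -norm; transitivity (f ^+ 5 * g5 (k ^+ 5) * (f * k)); [rewrite fk|]; ring.
  apply: (psI E10); apply: (psI (ps_exp0 6 E50)).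
  transitivity (5%:R * (psq * E 5 ^+ 6) * (E 1 * V1) + E 1 ^+ 6 * (E 5 * V5) ^+ 6).
    by rewrite /W; ring.
  rewrite E1V E5V qE5 expr1n !mulr1.
  transitivity (E 1 * (E 5 * V5) ^+ 6 * f ^+ 5 * p); last by ring.
  by rewrite E5V Ef /g5 /u5 /p; ring.
have hf : ps_hom 5 0 (V5 ^+ 6 * f ^+ 5).
  rewrite -[0%N]/(0 * 6 + 0 * 5)%N; apply: ps_homM; apply: ps_homX => //.
  by rewrite fF; exact: ps_hom_expand.
have Wn : W m.+1 = 0.
  have z (i : nat) (c : pser K) : (m.+1 != i %[mod 5])%N -> ps_hom 5 0 c ->
      ps_part 5 m.+1 (k ^+ i * c) = 0.
    move=> mi hc; apply: (@ps_part0 _ _ _ (1 * i + 0)); first by rewrite mul1n addn0.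
    by apply: ps_homM => //; exact: ps_homX.
  have part_p : ps_part 5 m.+1 p = 0.
    have m5' : ((m.+1 %% 5 == 1) || (m.+1 %% 5 == 4))%N by move: m5; rewrite !inE; lia.
    rewrite 6!ps_partD (@ps_part0 _ _ _ 0 1); [|by lia|exact: ps_hom1].
    rewrite !z ?addr0 //; try (by lia); try exact: ps_hom_nat; exact/ps_homN/ps_hom_nat.
  have := congr1 (fun x : pser K => x m.+1) (ps_partM0 m.+1 p hf).
  by rewrite part_p mulr0 -WE /= eqxx.
have := congr1 (fun x : pser K => x m.+1) qD; rewrite coef_psB Wn.
rewrite -[psq]expr1 coef_psqXM /= subn1 /= => ->; rewrite add0r coef_psM big1 ?oppr0 // => i _.
have hV2 : ps_hom 13 0 (V13 ^+ 2) by rewrite -(mul0n 2); exact: ps_homX.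
(* Since E_13^(-2) has only exponents divisible by 13, i must agree with m + 1 modulo 13, which is
   one of 3, 4, 6, 8, 10, 11: the residues that are not pentagonal. *)
case: (eqVneq (i %% 13)%N (m.+1 %% 13)%N) => [im|im].
  by rewrite coef_euler_mod13 ?mul0r // im; move: m13; rewrite !inE; lia.
rewrite hV2 ?mulr0 //; apply: contra im => /eqP mi.
have le_i : (i <= m.+1)%N by rewrite -ltnS.
have := modnDmr i (m.+1 - i) 13; rewrite mi mod0n addn0 subnKC // => ->.
exact: eqxx.
Qed.

End Vanishing.

(** * The theta series of A4 *)

Definition vec5 : Type := (int * int * int * int * int)%type.
HB.instance Definition _ := Choice.on vec5.

Section Box.
Variable M : nat.

(** A finite window of Z^5 whose coordinates are shifted by M, the same shift as between exponents
    and indices in [jsum]. *)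
Definition box5 : finType := ('I_M.*2.+1 * 'I_M.*2.+1 * 'I_M.*2.+1 * 'I_M.*2.+1 * 'I_M.*2.+1)%type.

Definition box_vec (p : box5) : vec5 :=
  let: (p0, p1, p2, p3, p4) := p in
  (p0%:Z - M%:Z, p1%:Z - M%:Z, p2%:Z - M%:Z, p3%:Z - M%:Z, p4%:Z - M%:Z).

Definition in_box5 (x : vec5) : bool :=
  let: (x0, x1, x2, x3, x4) := x in
  [&& (`|x0| <= M)%N, (`|x1| <= M)%N, (`|x2| <= M)%N, (`|x3| <= M)%N & (`|x4| <= M)%N].

Lemma box_vec_inj : injective box_vec.
Proof.
move=> [[[[p0 p1] p2] p3] p4] [[[[r0 r1] r2] r3] r4] [] e0 e1 e2 e3 e4.
by do 4?congr pair; apply/val_inj => /=; lia.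
Qed.

Lemma box_vec_onto x : in_box5 x -> exists p, box_vec p = x.
Proof.
case: x => [[[[x0 x1] x2] x3] x4] /and5P[b0 b1 b2 b3 b4].
have ex (y : int) : (`|y| <= M)%N -> exists j : 'I_M.*2.+1, j%:Z - M%:Z = y.
  move=> yM; have jM : (`|(y + M%:Z)%R| < M.*2.+1)%N by lia.
  by exists (Ordinal jM) => /=; lia.
have [p0 <-] := ex _ b0; have [p1 <-] := ex _ b1; have [p2 <-] := ex _ b2.
have [p3 <-] := ex _ b3; have [p4 <-] := ex _ b4.
by exists (p0, p1, p2, p3, p4).
Qed.

Variable P : pred vec5.
Hypothesis boxP : forall x, P x -> in_box5 x.

Lemma box5_finite : finite_set [set x | P x]%classic.
Proof.
apply: (@sub_finite_set _ _ (box_vec @` setT)%classic); last exact: finite_image.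
by move=> x /= /boxP/box_vec_onto[p <-]; exists p.
Qed.

Lemma box5_perm :
  perm_eq (fset_set [set x | P x]%classic) [seq box_vec p | p <- enum [pred p | P (box_vec p)]].
Proof.
apply: uniq_perm; first exact: fset_uniq.
  by rewrite map_inj_uniq ?enum_uniq //; exact: box_vec_inj.
move=> x; rewrite in_fset_set; last exact: box5_finite.
apply/idP/mapP => [|[p]]; rewrite ?mem_enum ?inE.
  by move=> Px; have [p px] := box_vec_onto (boxP Px); exists p; rewrite ?mem_enum ?inE px.
by move=> Pp ->; rewrite ?inE.
Qed.

Lemma sum_box5 (V : zmodType) (w : vec5 -> V) :
  \sum_(x <- fset_set [set x | P x]%classic) w x = \sum_(p : box5 | P (box_vec p)) w (box_vec p).
Proof.
by rewrite (perm_big _ box5_perm) big_map big_enum_cond; apply: eq_bigl => p; rewrite inE andbT.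
Qed.

End Box.

Definition sum5 (x : vec5) : int :=
  let: (x0, x1, x2, x3, x4) := x in x0 + x1 + x2 + x3 + x4.
Definition wt5 (e : nat -> int -> nat) (x : vec5) : nat :=
  let: (x0, x1, x2, x3, x4) := x in (e 0 x0 + e 1 x1 + e 2 x2 + e 3 x3 + e 4 x4)%N.

Lemma regroup5 (R : comNzRingType) (a0 b0 a1 b1 a2 b2 a3 b3 a4 b4 : R) :
  (a0 * b0) * (a1 * b1) * (a2 * b2) * (a3 * b3) * (a4 * b4) =
  (b0 * b1 * b2 * b3 * b4) * (a0 * a1 * a2 * a3 * a4).
Proof. by ring. Qed.

Section CoefficientExtraction.
Variables (K : comNzRingType) (M : nat).

Definition box_sum (p : box5 M) : nat :=
  let: (p0, p1, p2, p3, p4) := p in (p0 + p1 + p2 + p3 + p4)%N.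
Definition box_exp (c : nat -> K) (p : box5 M) : K :=
  let: (p0, p1, p2, p3, p4) := p in
  c 0%N ^+ p0 * c 1%N ^+ p1 * c 2%N ^+ p2 * c 3%N ^+ p3 * c 4%N ^+ p4.

Lemma coefp_lift m (f : pser K) (g : pser {poly K}) :
  ps_map (coefp m) (ps_map polyC f * g) = f * ps_map (coefp m) g.
Proof.
apply: pserP => n; rewrite /= !coef_psM coef_sum; apply: eq_bigr => i _.
by rewrite /= coefCM.
Qed.

Lemma coefp_term m (P : {poly K}) e : ps_map (coefp m) (psC P * psq ^+ e) = psC P`_m * psq ^+ e.
Proof.
apply: pserP => n /=; rewrite !coef_psCM !coef_psqX; case: (n == e).
  by rewrite mulr1n !mulr1.
by rewrite mulr0n !mulr0 coef0.
Qed.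

Definition theta_factor (e : nat -> int -> nat) (c : nat -> K) i : pser {poly K} :=
  \sum_(j < M.*2.+1) psq ^+ e i (j%:Z - M%:Z) * psC ((c i)%:P * 'X) ^+ j.

Lemma coefp_theta5 (e : nat -> int -> nat) (c : nat -> K) m :
  ps_map (coefp m) (theta_factor e c 0 * theta_factor e c 1 * theta_factor e c 2 *
    theta_factor e c 3 * theta_factor e c 4) =
  \sum_(p : box5 M | box_sum p == m) psC (box_exp c p) * psq ^+ wt5 e (box_vec p).
Proof.
rewrite /theta_factor; do 4![rewrite big_distrlr pair_big].
rewrite raddf_sum [RHS]big_mkcond; apply: eq_bigr => -[[[[p0 p1] p2] p3] p4] _.
transitivity (ps_map (coefp m) (psC ((box_exp c (p0, p1, p2, p3, p4))%:P *
    'X^(box_sum (p0, p1, p2, p3, p4))) * psq ^+ wt5 e (box_vec (p0, p1, p2, p3, p4)))).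
  congr ps_map; rewrite /= -!rmorphXn regroup5 -!rmorphM -!exprD; congr (psC _ * _).
  by rewrite !exprMn regroup5 -!exprD mulrC !rmorphM !rmorphXn.
rewrite coefp_term coefCM coefXn eq_sym; case: eqP; first by rewrite mulr1.
by rewrite mulr0 rmorph0 mul0r.
Qed.

End CoefficientExtraction.

Lemma prod_split5 (R : comNzRingType) m (G : nat -> R) : \prod_(i < 5 * m) G i = \prod_(j < m)
  (G (5 * j)%N * G (5 * j + 1)%N * G (5 * j + 2)%N * G (5 * j + 3)%N * G (5 * j + 4)%N).
Proof.
elim: m => [|m IH]; first by rewrite muln0 !big_ord0.
by rewrite mulnSr !addnS addn0 !big_ord_recr /= IH !addnS !addn0 !mulrA.
Qed.

Lemma coefp_jsum (K : comNzRingType) a b N d m : (0 < d)%N -> (m < N.*2.+1)%N ->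
  ps_map (coefp (d * m)) (jsum a b N (psC 'X^d)) = psq ^+ jexp a b (m%:Z - N%:Z) :> pser K.
Proof.
move=> d0 lt_m; rewrite raddf_sum (bigD1 (Ordinal lt_m)) //= big1 ?addr0 => [|j jm];
  rewrite -rmorphXn mulrC coefp_term -exprM coefXn.
  by rewrite eqxx rmorph1 mul1r.
case: eqP => [e|_]; last by rewrite rmorph0 mul0r.
case/negP: jm; apply/eqP/val_inj => /=; move/eqP: e.
by rewrite eqn_pmul2l // => /eqP.
Qed.

Lemma character_factor (R : comNzRingType) (w x u v : R) :
  1 + w + w ^+ 2 + w ^+ 3 + w ^+ 4 = 0 ->
  (x + u) * (1 + x * v) * ((w * x + u) * (1 + w * x * v)) *
  ((w ^+ 2 * x + u) * (1 + w ^+ 2 * x * v)) * ((w ^+ 3 * x + u) * (1 + w ^+ 3 * x * v)) *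
  ((w ^+ 4 * x + u) * (1 + w ^+ 4 * x * v)) = (x ^+ 5 + u ^+ 5) * (1 + x ^+ 5 * v ^+ 5).
Proof.
move=> w5; have e1 := cyclo5_norm w5 (- x) u; have e2 := cyclo5_norm w5 (- (x * v)) 1.
transitivity ((u ^+ 5 - (- x) ^+ 5) * (1 ^+ 5 - (- (x * v)) ^+ 5)); last by ring.
by rewrite -e1 -e2; ring.
Qed.

(** Each factor of the product runs through its five conjugates, so [cyclo5_norm] collapses it to a
    factor in x^5 and q^5. *)
Lemma jprod_character (R : comNzRingType) M (w x : pser R) :
  1 + w + w ^+ 2 + w ^+ 3 + w ^+ 4 = 0 ->
  jprod 1 0 M x * jprod 1 0 M (w * x) * jprod 1 0 M (w ^+ 2 * x) *
    jprod 1 0 M (w ^+ 3 * x) * jprod 1 0 M (w ^+ 4 * x) = jprod 5 0 M (x ^+ 5).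
Proof.
move=> w5; rewrite !jprod10 -!big_split /=; apply: eq_bigr => n _.
rewrite (character_factor _ _ _ w5) -!exprM.
by congr ((_ + _ ^+ _) * (1 + _ * _ ^+ _)); lia.
Qed.

Lemma eqm_prod5 (R : comNzRingType) N (a0 b0 a1 b1 a2 b2 a3 b3 a4 b4 : pser R) :
  eqm N a0 b0 -> eqm N a1 b1 -> eqm N a2 b2 -> eqm N a3 b3 -> eqm N a4 b4 ->
  eqm N (a0 * a1 * a2 * a3 * a4) (b0 * b1 * b2 * b3 * b4).
Proof. by move=> h0 h1 h2 h3 h4; do 4?apply: eqmM. Qed.

Lemma eqm_prod5_scale (R : comNzRingType) N (e s j t0 p0 t1 p1 t2 p2 t3 p3 t4 p4 P : pser R) :
  eqm N (e * p0) t0 -> eqm N (e * p1) t1 -> eqm N (e * p2) t2 -> eqm N (e * p3) t3 ->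
  eqm N (e * p4) t4 -> p0 * p1 * p2 * p3 * p4 = P -> eqm N (s * P) j ->
  eqm N (s * (t0 * t1 * t2 * t3 * t4)) (e ^+ 5 * j).
Proof.
move=> h0 h1 h2 h3 h4 <- sj; apply: eqm_trans (eqmM (@eqm_refl _ _ (e ^+ 5)) sj).
have -> : e ^+ 5 * (s * (p0 * p1 * p2 * p3 * p4)) =
  s * (e * p0 * (e * p1) * (e * p2) * (e * p3) * (e * p4)) by ring.
by apply: eqmM => //; apply/eqm_sym; exact: eqm_prod5.
Qed.

Section ThetaSeries.
Variable K : fieldType.
Local Notation L := {poly K}.
Local Notation E d := (euler K d).

Let lift d : euler L d = ps_map polyC (E d).
Proof. exact/esym/(ps_map_euler (polyC : {rmorphism K -> L})). Qed.

(** The auxiliary variable X records the coordinate sum: because of the shift by M, X^(5 M) selects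
    the vectors of sum zero. On the product side only the central term of the theta sum in X^5 has
    this degree, and its power of q is 1. *)
Lemma theta_character M (w : K) : 1 + w + w ^+ 2 + w ^+ 3 + w ^+ 4 = 0 ->
  eqm M (E 5 * \sum_(p : box5 M | box_sum p == 5 * M)
      psC (box_exp (fun i => w ^+ i) p) * psq ^+ wt5 (fun=> tri) (box_vec p))
    (E 1 ^+ 5).
Proof.
move=> w5; pose c i := w ^+ i.
have JT i : eqm M (euler L 1 * jprod 1 0 M (psC (c i)%:P * psC 'X)) (theta_factor M (fun=> tri) c i).
  have -> : theta_factor M (fun=> tri) c i = jsum 1 0 M (psC (c i)%:P * psC 'X).
    by apply: eq_bigr => j _; rewrite jexp10 rmorphM.
  exact: (@triple_product L 1 0 isT M).
have Z5 : 1 + psC w%:P + psC w%:P ^+ 2 + psC w%:P ^+ 3 + psC w%:P ^+ 4 = 0 :> pser L.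
  by rewrite -!rmorphXn -(rmorph1 (@psC L)) -(rmorph1 polyC) -!rmorphD w5 !rmorph0.
have := jprod_character M (psC 'X) Z5.
have cE i : psC (c i)%:P = psC w%:P ^+ i :> pser L by rewrite /c !rmorphXn.
have := @triple_product L 5 0 isT M (psC 'X ^+ 5); rewrite addn0 => J5 prodE.
have := JT 0%N; have := JT 1%N; have := JT 2%N; have := JT 3%N; have := JT 4%N.
rewrite !cE expr0 expr1 [1 * _]mul1r => J4 J3 J2 J1 J0.
have H := eqm_prod5_scale J0 J1 J2 J3 J4 prodE J5.
have := eqm_map (coefp (5 * M)) H; rewrite !lift -(rmorphXn (ps_map polyC)) -(rmorphXn (@psC L)).
rewrite 2!coefp_lift coefp_theta5 coefp_jsum //; last by lia.
by rewrite subrr /jexp !muln0 expr0 mulr1.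
Qed.

(** Half of 5 y^2 + (2 i - 3) y. On vectors of sum zero the total is the size of a 5-core in the
    lattice parametrization, whence the name and the series E_5^5 / E_1. *)
Definition core_exp i : int -> nat := jexp i.+1 (4 - i).

Lemma jprod_core (R : comNzRingType) M (x : pser R) :
  jprod 1 4 M x * jprod 2 3 M x * jprod 3 2 M x * jprod 4 1 M x * jprod 5 0 M x =
  jprod 1 0 (5 * M) x.
Proof.
rewrite jprod10 (prod_split5 _ (fun n => (x + psq ^+ n) * (1 + x * psq ^+ n.+1))).
rewrite -!big_split /=; apply: eq_bigr => n _; rewrite !regroup5 mulrC [RHS]mulrC.
congr (_ * _).
  have swap (a0 a1 a2 a3 a4 : pser R) : a0 * a1 * a2 * a3 * a4 = a4 * a3 * a2 * a1 * a0 by ring.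
  rewrite swap; congr ((_ + _ ^+ _) * (_ + _ ^+ _) * (_ + _ ^+ _) * (_ + _ ^+ _) * (_ + _ ^+ _)); lia.
by congr ((_ + _ * _ ^+ _) * (_ + _ * _ ^+ _) * (_ + _ * _ ^+ _) * (_ + _ * _ ^+ _) *
  (_ + _ * _ ^+ _)); lia.
Qed.

(** The five products of modulus 5 interleave into one product of modulus 1, whose theta sum has a
    single term of each degree in X. Every coordinate sum thus gives the same series, up to a power
    of q. *)
Lemma theta_core M m : (m <= 10 * M)%N ->
  eqm M (E 1 * \sum_(p : box5 M | box_sum p == m)
      psC (box_exp (fun=> 1) p) * psq ^+ wt5 core_exp (box_vec p))
    (E 5 ^+ 5 * psq ^+ tri (m%:Z - (5 * M)%:Z)).
Proof.
move=> le_m; pose c (i : nat) : K := 1.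
have JT i : (i <= 4)%N ->
    eqm M (euler L 5 * jprod i.+1 (4 - i) M (psC 'X)) (theta_factor M core_exp c i).
  move=> i4; have -> : theta_factor M core_exp c i = jsum i.+1 (4 - i) M (psC 'X).
    by apply: eq_bigr => j _; rewrite /c rmorph1 mul1r.
  have := @triple_product L i.+1 (4 - i) isT M (psC 'X).
  by rewrite (_ : i.+1 + (4 - i) = 5)%N //; lia.
have J : eqm M (euler L 1 * jprod 1 0 (5 * M) (psC 'X)) (jsum 1 0 (5 * M) (psC 'X)).
  by apply: eqm_le (@triple_product L 1 0 isT (5 * M) (psC 'X)); rewrite leq_pmull.
have H := eqm_prod5_scale (JT 0%N isT) (JT 1%N isT) (JT 2%N isT) (JT 3%N isT) (JT 4%N isT)
  (jprod_core M (psC 'X)) J.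
have := eqm_map (coefp m) H; rewrite !lift -(rmorphXn (ps_map polyC)).
rewrite !coefp_lift coefp_theta5.
rewrite -{2}[m]mul1n -['X]expr1 coefp_jsum //; last by lia.
by rewrite jexp10.
Qed.

End ThetaSeries.

Definition vcount (T : choiceType) (P : pred T) : nat := #|` fset_set [set x | P x]%classic|.

Lemma vcount_bij (T U : choiceType) (P : pred T) (Q : pred U) (g : T -> U) :
  finite_set [set x | P x]%classic -> {in P &, injective g} ->
  (forall y, Q y <-> exists2 x, P x & g x = y) -> vcount Q = vcount P.
Proof.
move=> finP injg QP; rewrite /vcount.
have -> : [set y | Q y]%classic = (g @` [set x | P x])%classic.
  by apply/seteqP; split=> y /=; [move=> /QP[x Px gx]; exists x | move=> [x Px gx]; apply/QP; exists x].
rewrite fset_set_image // card_in_imfset //= => x y.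
by rewrite !in_fset_set // !inE; exact: injg.
Qed.

Lemma vcount_sum (R : nzRingType) (M : nat) (P : pred vec5) : (forall x, P x -> in_box5 M x) ->
  (vcount P)%:R = \sum_(p : box5 M | P (box_vec p)) 1 :> R.
Proof.
by move=> PM; rewrite -(sum_box5 PM (fun=> 1 : R)) big_const_seq count_predT iter_addr_0.
Qed.

Lemma coef_monomial_sum (R : comNzRingType) (I : finType) (A : pred I) (c : I -> R) (e : I -> nat) n :
  (\sum_(i | A i) psC (c i) * psq ^+ e i) n = \sum_(i | A i && (e i == n)) c i.
Proof.
rewrite coef_ps_sum big_mkcondr; apply: eq_bigr => i _; rewrite coef_psCM coef_psqX eq_sym.
by case: eqP; rewrite ?mulr1 ?mulr0.
Qed.

Lemma box_sumE M (p : box5 M) : sum5 (box_vec p) = (box_sum p)%:Z - (5 * M)%:Z.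
Proof. by case: p => [[[[p0 p1] p2] p3] p4] /=; lia. Qed.

(** On vectors of sum zero the linear parts of the triangular numbers cancel and the weight is half
    the norm, so these are the shells of A4. *)
Definition shell n : pred vec5 := [pred x | (sum5 x == 0) && (wt5 (fun=> tri) x == n)].
Definition shell_class (x : vec5) : nat :=
  let: (x0, x1, x2, x3, x4) := x in `|((x1 + 2 * x2 + 3 * x3 + 4 * x4) %% 5)%Z|%N.
Definition core_shell r n : pred vec5 := [pred y | (sum5 y == r) && (wt5 core_exp y == n)].

Lemma shellE n x : shell n x = (sum5 x == 0) && (wt5 (fun=> tri) x == n).
Proof. by []. Qed.
Lemma core_shellE r n y : core_shell r n y = (sum5 y == r) && (wt5 core_exp y == n).
Proof. by []. Qed.

Lemma sqr_bound (y : int) (n : nat) : y * y <= 2 * n%:Z -> (`|y| <= 2 * n)%N.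
Proof. by nia. Qed.

Lemma shell_box n M x : (2 * n <= M)%N -> shell n x -> in_box5 M x.
Proof.
case: x => [[[[x0 x1] x2] x3] x4] le_M /andP[/= /eqP s0 /eqP sn].
have := triE x0; have := triE x1; have := triE x2; have := triE x3; have := triE x4.
move: sn; move: (tri _) (tri _) (tri _) (tri _) (tri _) => t0 t1 t2 t3 t4 sn h4 h3 h2 h1 h0.
have sq : x0 * x0 + x1 * x1 + x2 * x2 + x3 * x3 + x4 * x4 = 2 * n%:Z by nia.
have pos (y : int) : 0 <= y * y by rewrite -expr2 sqr_ge0.
have bd (y : int) : y * y <= 2 * n%:Z -> (`|y| <= M)%N.
  by move=> /sqr_bound le_y; exact: leq_trans le_y le_M.
have := pos x0; have := pos x1; have := pos x2; have := pos x3; have := pos x4.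
move=> p4 p3 p2 p1 p0.
by apply/and5P; split; apply: bd; lia.
Qed.

Lemma core_box M y : (wt5 core_exp y < M)%N -> in_box5 M y.
Proof.
case: y => [[[[y0 y1] y2] y3] y4].
rewrite [wt5 _ _]/(jexp 1 4 y0 + jexp 2 3 y1 + jexp 3 2 y2 + jexp 4 1 y3 + jexp 5 0 y4)%N.
have := @jexp_ge 5 0 isT y4; have := @jexp_ge 4 1 isT y3; have := @jexp_ge 3 2 isT y2.
have := @jexp_ge 2 3 isT y1; have := @jexp_ge 1 4 isT y0; rewrite /in_box5.
do 5!move: (absz _) => ?; do 5!move: (jexp _ _ _) => ?.
by move=> *; apply/and5P; split; lia.
Qed.

Lemma core_shell_box r n M y : (n < M)%N -> core_shell r n y -> in_box5 M y.
Proof. by move=> lt_n /andP[_ /eqP sn]; apply: core_box; rewrite sn. Qed.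

Section A4Theta.
Variable K : fieldType.
Local Notation E d := (euler K d).

Definition char_series (w : K) : pser K :=
  Pser (fun n => \sum_(x <- fset_set [set x | shell n x]%classic) w ^+ shell_class x).

Lemma char_seriesE (w : K) : 1 + w + w ^+ 2 + w ^+ 3 + w ^+ 4 = 0 ->
  E 5 * char_series w = E 1 ^+ 5.
Proof.
move=> w5; apply: eqmP => N; have w1 := cyclo5_unity w5; set M := (2 * N)%N.
have le_NM : (N <= M)%N by rewrite leq_pmull.
have H := @eqm_le _ _ _ _ _ le_NM (@theta_character K M w w5).
apply: (eqm_trans _ H); apply: eqmM => //.
move=> n lt_n; rewrite coef_monomial_sum -[char_series w n]/(\sum_(x <- _) _).
have boxn x : shell n x -> in_box5 M x by apply: shell_box; rewrite leq_mul2l ltnW.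
rewrite (sum_box5 boxn); apply: eq_big => p; rewrite shellE box_sumE.
  by congr (_ && _); lia.
case: p => [[[[p0 p1] p2] p3] p4] /= /andP[/eqP s0 _].
rewrite expr0 expr1n mul1r expr1 -!exprM -!exprD -[RHS](expr_mod _ w1) -[LHS](expr_mod _ w1).
by congr (_ ^+ _); lia.
Qed.

Definition core_series r : pser K := Pser (fun n => (vcount (core_shell r n))%:R).

Lemma core_seriesE (r : int) : E 1 * core_series r = E 5 ^+ 5 * psq ^+ tri r.
Proof.
apply: eqmP => N; set M := (N + `|r|)%N.
have le_NM : (N <= M)%N by rewrite leq_addr.
have le_m : (`|((5 * M)%:Z + r)%R| <= 10 * M)%N by rewrite /M; lia.
have H := @eqm_le _ _ _ _ _ le_NM (@theta_core K M _ le_m).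
have rE : (`|((5 * M)%:Z + r)%R|%N)%:Z - (5 * M)%:Z = r by rewrite /M; lia.
rewrite rE in H; apply: (eqm_trans _ H); apply: eqmM => // n lt_n.
rewrite coef_monomial_sum -[core_series r n]/((vcount _)%:R).
have boxn x : core_shell r n x -> in_box5 M x by apply: core_shell_box; exact: leq_trans le_NM.
rewrite (vcount_sum _ boxn); apply: eq_big => p; rewrite core_shellE box_sumE.
  by congr (_ && _); rewrite /M; lia.
by case: p => [[[[p0 p1] p2] p3] p4] /= _; rewrite !expr1n !mulr1.
Qed.

End A4Theta.

(* The circulant matrix of the Legendre symbol modulo 5 multiplies norms by 5 on the
   hyperplane sum5 = 0; its image is translated into the class 2. *)
Definition gauss5 (y : vec5) : vec5 :=
  let: (y0, y1, y2, y3, y4) := y in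
  (y4 + y1 - y3 - y2, y0 + y2 - y4 - y3 - 1, y1 + y3 - y0 - y4,
   y2 + y4 - y1 - y0 + 1, y3 + y0 - y2 - y1).

Definition shell2 n : pred vec5 := [pred x | shell n x && (shell_class x == 2)].
(** Adding (1,1,1,1,1) to y does not change [gauss5 y] but shifts the sum by 5; the bound on the sum
    keeps one representative. The weight condition is [gauss5_wt] solved for weight n. *)
Definition core_all n : pred vec5 :=
  [pred y | (`|sum5 y|%N <= 2)%N && ((wt5 core_exp y).+1 == n + tri (sum5 y))%N].

Lemma shell2E n x : shell2 n x = shell n x && (shell_class x == 2).
Proof. by []. Qed.
Lemma core_allE n y :
  core_all n y = (`|sum5 y|%N <= 2)%N && ((wt5 core_exp y).+1 == n + tri (sum5 y))%N.
Proof. by []. Qed.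

Lemma jexpE a b i : (jexp a b i)%:Z * 2 = a%:Z * (i * (i + 1)) + b%:Z * (i * (i - 1)).
Proof.
rewrite /jexp PoszD !PoszM mulrDl -!mulrA !triE; congr (_ + _ * _).
by rewrite mulNr -mulrN opprD opprK addrC.
Qed.

Lemma gauss5_wt y : (wt5 (fun=> tri) (gauss5 y) + tri (sum5 y) = wt5 core_exp y + 1)%N.
Proof.
case: y => [[[[y0 y1] y2] y3] y4].
rewrite [sum5 _]/(y0 + y1 + y2 + y3 + y4) [wt5 core_exp _]/(jexp 1 4 y0 + jexp 2 3 y1 +
  jexp 3 2 y2 + jexp 4 1 y3 + jexp 5 0 y4)%N [wt5 _ _]/(tri (y4 + y1 - y3 - y2) +
  tri (y0 + y2 - y4 - y3 - 1) + tri (y1 + y3 - y0 - y4) + tri (y2 + y4 - y1 - y0 + 1) +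
  tri (y3 + y0 - y2 - y1))%N.
have key : (tri (y4 + y1 - y3 - y2))%:Z * 2 + (tri (y0 + y2 - y4 - y3 - 1))%:Z * 2 +
    (tri (y1 + y3 - y0 - y4))%:Z * 2 + (tri (y2 + y4 - y1 - y0 + 1))%:Z * 2 +
    (tri (y3 + y0 - y2 - y1))%:Z * 2 + (tri (y0 + y1 + y2 + y3 + y4))%:Z * 2 =
    (jexp 1 4 y0)%:Z * 2 + (jexp 2 3 y1)%:Z * 2 + (jexp 3 2 y2)%:Z * 2 +
    (jexp 4 1 y3)%:Z * 2 + (jexp 5 0 y4)%:Z * 2 + 2.
  by rewrite !triE !jexpE; ring.
move: key; do 6!move: (tri _) => ?; do 5!move: (jexp _ _ _) => ?; lia.
Qed.

Lemma gauss5_sum y : sum5 (gauss5 y) = 0.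
Proof. by case: y => [[[[y0 y1] y2] y3] y4] /=; ring. Qed.

Lemma gauss5_class y : shell_class (gauss5 y) = 2.
Proof. by case: y => [[[[y0 y1] y2] y3] y4] /=; lia. Qed.

Lemma gauss5_inj n : {in core_all n &, injective gauss5}.
Proof.
move=> [[[[y0 y1] y2] y3] y4] [[[[z0 z1] z2] z3] z4].
rewrite !inE => /andP[hy _] /andP[hz _] [] e0 e1 e2 e3 e4.
by do 4?congr pair; move: hy hz; rewrite /=; lia.
Qed.

Lemma gauss5_onto x : sum5 x = 0 -> shell_class x = 2 -> exists2 y, (`|sum5 y|%N <= 2)%N & gauss5 y = x.
Proof.
case: x => [[[[x0 x1] x2] x3] x4] /= s0 cl.
have [t ct] : exists t, x1 + 2 * x2 + 3 * x3 + 4 * x4 = 5 * t + 2.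
  by exists ((x1 + 2 * x2 + 3 * x3 + 4 * x4) %/ 5)%Z; lia.
(* Solving [gauss5 y = x] leaves y2 free and makes the sum of y equal to 5 y2 - u2. So y2 is u2 / 5
   rounded to the nearest integer, and r is the resulting sum. *)
pose u2 := x1 + x3 - x0 - x4.
have [r [y2 [lr hr]]] : exists r y2, (`|r| <= 2)%N /\ u2 = 5 * y2 - r.
  by exists (2 - ((u2 + 2) %% 5)%Z), ((u2 + 2) %/ 5)%Z; lia.
exists (y2 + x4 - t, y2 + x2 + x3 + 2 * x4 - 3 * t - 1, y2,
  y2 + x2 + x3 + 2 * x4 - 2 * t - 1, y2 + x2 + 2 * x3 + 3 * x4 - 4 * t - 2).
  by move: lr hr; rewrite /u2 /=; lia.
by rewrite /=; do 4?congr pair; move: hr; rewrite /u2; lia.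
Qed.

Lemma vcount_shell2 n : vcount (shell2 n) = vcount (core_all n).
Proof.
apply: (@vcount_bij _ _ _ _ gauss5).
- apply: (@box5_finite (n + 5)) => y; rewrite core_allE => /andP[ly /eqP hy].
  by apply: core_box; have := triE (sum5 y); nia.
- exact: gauss5_inj.
move=> x; rewrite shell2E shellE; split=> [/andP[/andP[/eqP s0 /eqP sn] /eqP cl]|[y + <-]].
  have [y ly yx] := gauss5_onto s0 cl; exists y => //; rewrite core_allE ly /=.
  by have := gauss5_wt y; rewrite yx sn => ->; rewrite addn1.
rewrite core_allE => /andP[ly /eqP hy]; rewrite gauss5_sum gauss5_class !eqxx /= andbT.
by have := gauss5_wt y; rewrite addn1 hy => /addIn ->.
Qed.

Section A4ThetaIdentity.
Variables (K : fieldType) (zeta : K).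
Hypothesis zeta5 : 1 + zeta + zeta ^+ 2 + zeta ^+ 3 + zeta ^+ 4 = 0.
Local Notation E d := (euler K d).

(** The shift by [tri r] in the weight cancels the factor q^(tri r) of [core_seriesE], so the five
    admissible sums contribute equally. *)
Lemma vcount_core_all n : (vcount (core_all n))%:R = 5%:R * (psq * (psV (E 1) * E 5 ^+ 5)) n :> K.
Proof.
have box (y : vec5) : core_all n y -> in_box5 (n + 5) y.
  rewrite core_allE => /andP[ly /eqP hy]; apply: core_box.
  by have := triE (sum5 y); nia.
rewrite (vcount_sum _ box).
pose S r : K := \sum_(p : box5 (n + 5) | (sum5 (box_vec p) == r) &&
  ((wt5 core_exp (box_vec p)).+1 == n + tri r)%N) 1.
have SE r : (`|r|%N <= 2)%N -> S r = (psq * (psV (E 1) * E 5 ^+ 5)) n.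
  move=> lr.
  have coreE : core_series K r = psq ^+ tri r * (psV (E 1) * E 5 ^+ 5).
    apply: (psI (euler0 K (isT : 0 < 1)%N)); rewrite core_seriesE mulrCA.
    by rewrite [E 1 * _]mulrA psVr ?euler0 // mul1r mulrC.
  have := coef_psqXM (tri r) (psq * (psV (E 1) * E 5 ^+ 5)) (n + tri r).
  rewrite ltnNge leq_addl /= addnK mulrCA -coreE -{1}[psq]expr1 coef_psqXM => <-.
  case: ltnP => [lt1|ge1].
    by rewrite /S big1 // => p /andP[_ /eqP]; lia.
  have boxr y : core_shell r (n + tri r - 1)%N y -> in_box5 (n + 5) y.
    by apply: core_shell_box; have := triE r; nia.
  rewrite [RHS](vcount_sum _ boxr); apply: eq_bigl => p.
  by rewrite core_shellE; congr (_ && _); lia.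
transitivity (S (-2) + S (-1) + S 0 + S 1 + S 2); last by rewrite !SE //; ring.
rewrite /S [LHS]big_mkcond 5!(big_mkcond (fun p => (sum5 (box_vec p) == _) && _)).
rewrite -!big_split /=; apply: eq_bigr => p _; rewrite core_allE.
move: (sum5 (box_vec p)) (wt5 core_exp (box_vec p)) => u w.
case: (leqP `|u|%N 2) => [lu|gu] /=.
  have : u = -2 \/ u = -1 \/ u = 0 \/ u = 1 \/ u = 2 by lia.
  by case=> [|[|[|[|]]]] -> /=; rewrite !(addr0, add0r).
have F r : (`|r|%N <= 2)%N -> (u == r) = false by move=> lr; apply/eqP => ur; rewrite ur in gu; lia.
by rewrite !F //= !addr0.
Qed.

(** Fourier inversion on Z/5 for the class 2: zeta^(3 j) is the conjugate of zeta^(2 j). By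
    [char_seriesE] all four nontrivial characters have the same series, and zeta^3 + zeta^6 + zeta^9
    + zeta^12 = -1, so a single class determines the whole count. *)
Lemma theta_shell n : (vcount (shell n))%:R =
  char_series zeta n + 5%:R * (vcount (core_all n))%:R :> K.
Proof.
have u5 := cyclo5_unity zeta5; have E50 := euler0 K (isT : 0 < 5)%N.
have charE j : ~~ (5 %| j)%N -> char_series (zeta ^+ j) = char_series zeta.
  move=> j5; apply: (psI E50); rewrite (char_seriesE zeta5) char_seriesE //.
  exact: cyclo5_exp zeta5 j j5.
have box x : shell n x -> in_box5 (2 * n) x by exact: shell_box.
have box2 x : shell2 n x -> in_box5 (2 * n) x by rewrite shell2E => /andP[/box].
rewrite -vcount_shell2 (vcount_sum _ box2).
have charN j : ~~ (5 %| j)%N -> \sum_(p : box5 (2 * n) | shell n (box_vec p))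
    zeta ^+ (j * shell_class (box_vec p)) = char_series zeta n.
  move=> j5; rewrite -(charE j j5) -[RHS]/(\sum_(x <- _) _) (sum_box5 box).
  by apply: eq_bigr => p _; rewrite exprM.
have : \sum_(p : box5 (2 * n) | shell n (box_vec p)) (1 +
    (zeta ^+ 3 * zeta ^+ (1 * shell_class (box_vec p)) +
     zeta ^+ 6 * zeta ^+ (2 * shell_class (box_vec p)) +
     zeta ^+ 9 * zeta ^+ (3 * shell_class (box_vec p)) +
     zeta ^+ 12 * zeta ^+ (4 * shell_class (box_vec p)))) =
  5%:R * \sum_(p : box5 (2 * n) | shell2 n (box_vec p)) 1.
  rewrite mulr_sumr [RHS]big_mkcond [LHS]big_mkcond; apply: eq_bigr => p _.
  rewrite shell2E; case: (shell n _) => //=.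
  have : (shell_class (box_vec p) < 5)%N by case: (box_vec p) => [[[[x0 x1] x2] x3] x4] /=; lia.
  move: (shell_class _) => c lt_c.
  have -> : zeta ^+ 3 * zeta ^+ (1 * c) + zeta ^+ 6 * zeta ^+ (2 * c) +
      zeta ^+ 9 * zeta ^+ (3 * c) + zeta ^+ 12 * zeta ^+ (4 * c) =
      zeta ^+ (3 + c) + (zeta ^+ (3 + c)) ^+ 2 + (zeta ^+ (3 + c)) ^+ 3 + (zeta ^+ (3 + c)) ^+ 4.
    by rewrite -!exprD -!exprM; congr (_ ^+ _ + _ ^+ _ + _ ^+ _ + _ ^+ _); lia.
  case: (boolP (5 %| 3 + c)%N) => [d|nd].
    have -> : c = 2 by lia.
    by rewrite u5 !expr1n eqxx mulr1; ring.
  have := cyclo5_exp zeta5 nd; rewrite -!addrA => ->.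
  by case: eqP nd => // ->.
rewrite big_split /= !big_split /= -!big_distrr /= !charN // -(vcount_sum _ box) => e.
have z0 : 1 + zeta ^+ 3 + zeta ^+ 6 + zeta ^+ 9 + zeta ^+ 12 = 0.
  have nd : ~~ (5 %| 3)%N by [].
  by rewrite -[RHS](cyclo5_exp zeta5 nd) -!exprM.
rewrite -e -[\sum_(x <- _) _]/(char_series zeta n).
move: (char_series zeta n) (_%:R) => b t.
transitivity (t + (1 + zeta ^+ 3 + zeta ^+ 6 + zeta ^+ 9 + zeta ^+ 12) * b).
  by rewrite z0 mul0r addr0.
by ring.
Qed.

Definition theta_series : pser K := Pser (fun n => (vcount (shell n))%:R).

Lemma theta_series_identity :
  theta_series * E 1 * E 5 = E 1 ^+ 6 + 25%:R * (psq * E 5 ^+ 6).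
Proof.
have E10 := euler0 K (isT : 0 < 1)%N.
have -> : theta_series = char_series zeta + 25%:R * (psq * (psV (E 1) * E 5 ^+ 5)).
  apply: pserP => n; rewrite -[theta_series n]/((vcount _)%:R) theta_shell vcount_core_all.
  have coefN (f : pser K) : (25%:R * f) n = 25%:R * f n.
    by rewrite -(rmorph_nat (@psC K)) coef_psCM.
  by rewrite coef_psD coefN; congr (_ + _); ring.
transitivity (E 1 * (E 5 * char_series zeta) + 25%:R * (psq * E 5 ^+ 6) * (E 1 * psV (E 1))).
  by ring.
by rewrite (char_seriesE zeta5) psVr // mulr1 -exprS.
Qed.

End A4ThetaIdentity.

(** Twice [qform m] is the sum of the squares of the m i plus the square of their sum, so appending
    minus the sum as fifth coordinate identifies the quadratic form with A4. *)
Lemma theta_vcount n : theta n = (vcount (shell n))%:Z.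
Proof.
congr Posz; rewrite /theta.
pose i1 : 'I_4 := lift ord0 ord0; pose i2 : 'I_4 := lift ord0 (lift ord0 ord0).
pose i3 : 'I_4 := lift ord0 (lift ord0 (lift ord0 ord0)).
pose h (m : {ffun 'I_4 -> int}) : vec5 :=
  (m ord0, m i1, m i2, m i3, - (m ord0 + m i1 + m i2 + m i3)).
have hE m : (wt5 (fun=> tri) (h m))%:Z = qform m.
  apply: (mulIf (_ : 2 != 0 :> int)) => //.
  have -> : qform m * 2 = m ord0 ^+ 2 + m i1 ^+ 2 + m i2 ^+ 2 + m i3 ^+ 2 +
      (m ord0 + m i1 + m i2 + m i3) ^+ 2.
    rewrite /qform; under [X in (_ + X) * 2]eq_bigr => j _ do rewrite big_mkcond.
    by rewrite !big_ord_recl !big_ord0 /= -/i1 -/i2 -/i3; ring.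
  have dist (a b c d e : nat) :
    (a + b + c + d + e)%N%:Z * 2 = a%:Z * 2 + b%:Z * 2 + c%:Z * 2 + d%:Z * 2 + e%:Z * 2 by lia.
  by rewrite [LHS]dist !triE; ring.
have -> : [set m | qform m = n%:Z]%classic = [set m | qform m == n%:Z]%classic.
  by apply/seteqP; split=> m /eqP.
symmetry; apply: (@vcount_bij _ _ (fun m => qform m == n%:Z) _ h).
- by apply: sub_finite_set (finite_qform_level n) => m /= /eqP.
- move=> m m' _ _ [e0 e1 e2 e3 _]; apply/ffunP => i.
  have : i \in [:: ord0; i1; i2; i3] by case: i => [[|[|[|[|k]]]] lt_k].
  by rewrite !inE => /or4P[] /eqP ->.
move=> [[[[x0 x1] x2] x3] x4]; rewrite shellE; split=> [/andP[/eqP s0 /eqP sn]|[m /eqP qm <-]].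
  pose m := [ffun i : 'I_4 => nth 0 [:: x0; x1; x2; x3] i].
  have hm : h m = (x0, x1, x2, x3, x4).
    by rewrite /h !ffunE /=; congr pair; move: s0 => /=; lia.
  by exists m => //; rewrite -hE hm sn.
rewrite -eqz_nat hE qm eqxx andbT /h /=; apply/eqP; lia.
Qed.

(** * Generalized Frobenius partitions *)

Lemma euler5_series : euler int 1 ^+ 5 = Pser euler5.
Proof.
apply: pserP => n; have E : eqm n.+1 (euler int 1) (eulerp int 1 n).
  by apply: eqm_euler; rewrite ?mul1n.
rewrite (eqmX 5 E) // eulerpE /= /euler5.
have -> : \prod_(i < n) (1 - psq ^+ (1 * i.+1)) =
    ps_of (\prod_(1 <= i < n.+1) (1 - 'X^i)) :> pser int.
  rewrite big_add1 /= big_mkord rmorph_prod; apply: eq_bigr => i _.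
  by rewrite rmorphB rmorph1 mul1n psqX.
by rewrite -rmorphXn prodrXl.
Qed.

Lemma cphi5_series : Pser cphi5 * euler int 1 ^+ 5 = Pser theta.
Proof. by rewrite euler5_series; apply: pserP => n; rewrite coef_psM -[RHS]/(theta n) -cphi5_gen. Qed.

Lemma field13_zeta5 : exists (K : fieldType) (z : K),
  13%N \in [pchar K] /\ 1 + z + z ^+ 2 + z ^+ 3 + z ^+ 4 = 0.
Proof.
(* The order of 13 modulo 5 is 4, so 13^4 is the least power of 13 whose field contains a primitive
   fifth root of unity. *)
have [F p13 cardF] := PrimePowerField (isT : prime 13) (isT : 0 < 4)%N.
have d5 : (5 %| #|[set: {unit F}]|)%N by rewrite card_finField_unit cardF.
have [u _ u5] := Cauchy (isT : prime 5) d5.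
exists F, (val u); split=> //.
have z5 : val u ^+ 5 = 1.
  by rewrite -FinRing.val_unitX -u5 expg_order.
have z1 : val u - 1 != 0.
  rewrite subr_eq0; apply/eqP => u1; move: u5.
  have -> : u = 1%g by apply: val_inj.
  by rewrite order1.
apply: (mulfI z1); rewrite mulr0.
have -> (y : F) : (y - 1) * (1 + y + y ^+ 2 + y ^+ 3 + y ^+ 4) = y ^+ 5 - 1 by ring.
by rewrite z5 subrr.
Qed.

Theorem theorem10 (n t : nat)
    (ht : t \in [:: 15; 25; 50; 75; 90; 100; 115; 140; 165; 175; 240; 275]%N) :
  (cphi5 (325 * n + t)%N = 0 %[mod 13])%Z.
Proof.
have [K [z [charK z5]]] := field13_zeta5.
pose C : pser K := ps_map intr (Pser cphi5).
have thetaK : ps_map intr (Pser theta) = theta_series K.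
  by apply: pserP => k; rewrite -[LHS]/((theta k)%:~R) theta_vcount.
have CE : C * euler K 1 ^+ 5 = theta_series K.
  by rewrite -thetaK -cphi5_series rmorphM rmorphXn /= ps_map_euler.
have CE6 : C * euler K 1 ^+ 6 * euler K 5 =
    euler K 1 ^+ 6 + 25%:R * (psq * euler K 5 ^+ 6).
  rewrite -(theta_series_identity z5) -CE; ring.
have K13 : 13%:R = 0 :> K by exact: pcharf0 charK.
(* Each t is a multiple of 5 and 325 = 5 * 65 with 65 = 5 * 13, so the residues of m modulo 5 and 13
   depend only on t. *)
have [m -> /andP[m5 m13]] : exists2 m, (325 * n + t = 5 * m)%N &
    ((m %% 5)%N \in [:: 0; 3]%N) && ((m %% 13)%N \in [:: 2;3;5;7;9;10]%N).
  exists (65 * n + t %/ 5)%N; first by move: ht; rewrite !inE; lia.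
  rewrite !inE; move: ht; rewrite !inE; do ?[case/orP => [/eqP->|]]; by lia.
have := vanishing K13 z5 CE6 m5 m13.
rewrite -[C _]/((cphi5 _)%:~R) => /eqP; rewrite -(dvdz_pcharf charK) => /dvdz_mod0P ->.
by rewrite mod0z.
Qed.
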